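(* Let $\mu=\sum_{k=1}^{n}a_k\delta_{b_k}+\mu_a$ be a Borel measure on $[0,1)$, where $a_k>0$ and $0<b_k<c$ for each $k$, $g$ is a Borel function bounded above and below almost everywhere, and $\mu_a$ is the absolutely continuous Borel measure on $[0,1)$ with Radon-Nikodym derivative $\chi_{[c,1)}g$. Then there is a frame $\{g_j\}_{j=-\infty}^{\infty}$ for $L^2(\mu)$ that is dextrodual to $\{e^{2\pi i j x}\}_{j=-\infty}^{\infty}$ in $L^2(\mu)$.
   Context: Here $\delta_b$ is the unit point mass at $b$; absolute continuity and the Radon-Nikodym derivative are with respect to Lebesgue measure. ''Bounded above and below'' means there are constants $0<m\le M<\infty$ with $m\le g\le M$ almost everywhere. A sequence $\{g_j\}$ in a Hilbert space $H$ is a frame if there are $A,B>0$ with $A\|f\|^2\le\sum_j|\langle f,g_j\rangle|^2\le B\|f\|^2$ for all $f\in H$. A sequence $\{g_j\}$ is dextrodual to a sequence $\{x_j\}$ in $H$ if for all $x\in H$, $x=\sum_j\langle x,g_j\rangle x_j$, with (possibly conditional) convergence in norm; for sequences indexed by $\mathbb Z$ the sum is the limit of the symmetric partial sums $\sum_{j=-M}^{M}$ as $M\to\infty$. *)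

(* Defs.v *)
From HB Require Import structures.
From mathcomp Require Import all_boot all_order all_algebra.
From mathcomp Require Import all_classical all_reals all_analysis.
From mathcomp Require Import complex.

Set Implicit Arguments.
Unset Strict Implicit.
Unset Printing Implicit Defensive.

Import Order.TTheory GRing.Theory Num.Theory.
Import numFieldNormedType.Exports.

Local Open Scope classical_set_scope.
Local Open Scope ring_scope.
Local Open Scope complex_scope.

(* The complex Hilbert space L^2(mu) is handled through representatives: every
   notion below depends on functions only up to mu-almost everywhere equality. *)
Section ComplexL2.
Context {d : measure_display} {T : measurableType d} {R : realType}.
Variable mu : {measure set T -> \bar R}.

Definition cmod (z : R[i]) : R := complex.Re `|z|.

Definition L2 (f : T -> R[i]) : Prop :=
  ((fun x => complex.Re (f x)) \in Lfun mu 2%:E) /\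
  ((fun x => complex.Im (f x)) \in Lfun mu 2%:E).

Definition L2norm (f : T -> R[i]) : \bar R :=
  Lnorm mu 2%:E (fun x => (cmod (f x))%:E).

(* linear in the first argument, conjugate-linear in the second *)
Definition L2dot (f h : T -> R[i]) : R[i] :=
  (\int[mu]_x complex.Re (f x * (h x)^*)) +i* (\int[mu]_x complex.Im (f x * (h x)^*)).

Definition is_frame (g : int -> T -> R[i]) : Prop :=
  (forall j, L2 (g j)) /\
  exists A B : R, 0 < A /\ 0 < B /\
    forall f, L2 f ->
      (A%:E * L2norm f ^+ 2
         <= \esum_(j in [set: int]) (cmod (L2dot f (g j)) ^+ 2)%:E)%E /\
      (\esum_(j in [set: int]) (cmod (L2dot f (g j)) ^+ 2)%:E
         <= B%:E * L2norm f ^+ 2)%E.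

(* the sum of F j over the integers j with -M <= j <= M *)
Definition symsum (F : int -> R[i]) (M : nat) : R[i] :=
  \sum_(i < M.*2.+1) F ((i : nat)%:Z - M%:Z).

Definition dextrodual (g e : int -> T -> R[i]) : Prop :=
  (forall j, L2 (g j)) /\ (forall j, L2 (e j)) /\
  forall f, L2 f ->
    (fun M : nat =>
       L2norm (fun t => f t - symsum (fun j => L2dot f (g j) * e j t) M))
      @ \oo --> 0%E.

End ComplexL2.

(* t |-> e^{2 pi i j t} *)
Definition expfun {R : realType} (j : int) (t : R) : R[i] :=
  cos (2 * pi * j%:~R * t) +i* sin (2 * pi * j%:~R * t).

Definition ae_bounded_above_below {R : realType} (D : set R) (g : R -> R) : Prop :=
  exists m M : R, 0 < m /\ m <= M /\
    {ae (@lebesgue_measure R), forall x, D x -> m <= g x <= M}.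

(* Main.v *)
Require Import Defs.
From mathcomp Require Import all_boot all_order all_algebra.
From mathcomp Require Import all_classical all_reals all_analysis.
From mathcomp Require Import complex.
From mathcomp Require Import measurable_realfun ring lra zify.

(* Extend f in L^2(mu) to a function F on [0,1): F = f on [c,1), F = f(b_k) on a
   small interval around b_k, F = 0 elsewhere (the intervals being disjoint and
   inside (0,c)). Then f |-> F is bounded above and below from L^2(mu) to
   L^2(0,1), and its adjoint applied to e_j gives g_j with <f,g_j> = F^(j). The
   frame inequalities are Parseval's identity for F. For the reconstruction, the
   symmetric Fourier sums of F converge to F in L^2(0,1), which handles [c,1), and
   they converge pointwise at each b_k because F is constant near b_k.
   Pointwise convergence at x uses Chernoff's trick: if F - F(x) = (e_1 - e_1(x)) G
   with G in L^2, the partial sum at x telescopes. The same fact and Fatou's lemma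
   give Parseval's identity for indicators of half-lines, and a Dynkin-class
   argument followed by monotone approximation extends it to all of L^2. *)

Import Order.TTheory GRing.Theory Num.Theory.
Import numFieldNormedType.Exports.
Import HBNNSimple.

Set Implicit Arguments.
Unset Strict Implicit.
Unset Printing Implicit Defensive.

Local Open Scope classical_set_scope.
Local Open Scope ring_scope.
Local Open Scope charge_scope.

Local Notation "x %:C" := (real_complex _ x) : ring_scope.

(** * Complex-valued square-integrable functions *)

(** The obstacle is that [mu] charges the points b_k, whereas Fourier coefficients with respect to
    Lebesgue measure do not see values at single points. Neither L2 convergence nor
    almost-everywhere convergence of a Fourier series says anything at the b_k, which form a null
    set. Since the density lives on [c,1) and every b_k lies in (0,c), there is free room around
    each b_k in which f(b_k) can be spread. The positive length of the interval makes the norm of F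
    control |f(b_k)|, and the flatness of F there forces convergence at b_k itself. The strict
    inequalities 0 < b_k < c are what leaves room on both sides. The frame bounds come from
    comparing the interval length with the masses a_k, and Lebesgue measure with the bounds on g. *)

Section ComplexNumbers.
Context {R : realType}.
Implicit Types z w : R[i].

Lemma reD z w : complex.Re (z + w) = complex.Re z + complex.Re w.
Proof. by case: z; case: w. Qed.
Lemma imD z w : complex.Im (z + w) = complex.Im z + complex.Im w.
Proof. by case: z; case: w. Qed.
Lemma reM z w : complex.Re (z * w) =
  complex.Re z * complex.Re w - complex.Im z * complex.Im w.
Proof. by case: z; case: w. Qed.
Lemma imM z w : complex.Im (z * w) =
  complex.Re z * complex.Im w + complex.Im z * complex.Re w.
Proof. by case: z => a b; case: w. Qed.
Lemma reJ z : complex.Re z^* = complex.Re z.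
Proof. by case: z. Qed.
Lemma imJ z : complex.Im z^* = - complex.Im z.
Proof. by case: z. Qed.
Lemma eq_ReIm z w : complex.Re z = complex.Re w ->
  complex.Im z = complex.Im w -> z = w.
Proof. by case: z => a b; case: w => a' b' /= -> ->. Qed.

Lemma cmod_sq z : cmod z ^+ 2 = complex.Re z ^+ 2 + complex.Im z ^+ 2.
Proof. by rewrite /cmod normc_def/= sqr_sqrtr// addr_ge0 ?sqr_ge0. Qed.

Lemma cmod_ge0 z : 0 <= cmod z.
Proof. by rewrite /cmod normc_def/= sqrtr_ge0. Qed.

Lemma cmod_sqM z w : cmod (z * w) ^+ 2 = cmod z ^+ 2 * cmod w ^+ 2.
Proof. by rewrite !cmod_sq reM imM; ring. Qed.

Lemma cmod_sqJ z : cmod z^* ^+ 2 = cmod z ^+ 2.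
Proof. by rewrite !cmod_sq reJ imJ sqrrN. Qed.

Lemma mulcJ z : z * z^* = (cmod z ^+ 2)%:C.
Proof. by apply: eq_ReIm; rewrite ?reM ?imM reJ imJ cmod_sq/=; ring. Qed.

(** The parallelogram law without its term |z - w|^2. It stands in for the triangle inequality of
    the L2 norm and avoids square roots; the factor 2 is harmless for finiteness and for convergence
    to 0. *)
Lemma cmod_sqD z w : cmod (z + w) ^+ 2 <= 2 * cmod z ^+ 2 + 2 * cmod w ^+ 2.
Proof.
case: z w => [a b] [a' b']; rewrite !cmod_sq/=.
have := addr_ge0 (sqr_ge0 (a - a')) (sqr_ge0 (b - b')); lra.
Qed.

Lemma cmod_sqB z w : cmod (z - w) ^+ 2 <= 2 * cmod z ^+ 2 + 2 * cmod w ^+ 2.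
Proof.
case: z w => [a b] [a' b']; rewrite !cmod_sq/=.
have := addr_ge0 (sqr_ge0 (a + a')) (sqr_ge0 (b + b')); lra.
Qed.

Lemma cmod0 : cmod (0 : R[i]) = 0.
Proof. by rewrite /cmod normr0. Qed.

End ComplexNumbers.

Section L2.
Context d (T : measurableType d) (R : realType) (mu : {measure set T -> \bar R}).
Implicit Types f h : T -> R[i].

Definition cmeasurable f := measurable_fun setT (fun x => complex.Re (f x)) /\
  measurable_fun setT (fun x => complex.Im (f x)).

Lemma cmeasurableD f h : cmeasurable f -> cmeasurable h ->
  cmeasurable (fun x => f x + h x).
Proof.
move=> [mf1 mf2] [mh1 mh2]; split.
- by under eq_fun do rewrite reD; exact: measurable_funD.
- by under eq_fun do rewrite imD; exact: measurable_funD.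
Qed.

Lemma cmeasurableM f h : cmeasurable f -> cmeasurable h ->
  cmeasurable (fun x => f x * h x).
Proof.
move=> [mf1 mf2] [mh1 mh2]; split.
- under eq_fun do rewrite reM.
  by apply: measurable_funB; exact: measurable_funM.
- under eq_fun do rewrite imM.
  by apply: measurable_funD; exact: measurable_funM.
Qed.

Lemma cmeasurable_cst (k : R[i]) : cmeasurable (fun=> k).
Proof. by split; exact: measurable_cst. Qed.

Lemma cmeasurable_real (u : T -> R) : measurable_fun setT u ->
  cmeasurable (fun x => (u x)%:C).
Proof. by move=> mu1; split => //=; exact: measurable_cst. Qed.

Lemma cmeasurableJ f : cmeasurable f -> cmeasurable (fun x => (f x)^*).
Proof.
move=> [mf1 mf2]; split; first by under eq_fun do rewrite reJ.
by under eq_fun do rewrite imJ; exact: measurable_funN.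
Qed.

Lemma cmeasurable_sum (I : Type) (s : seq I) (F : I -> T -> R[i]) :
  (forall i, cmeasurable (F i)) -> cmeasurable (fun x => \sum_(i <- s) F i x).
Proof.
move=> mF; elim: s => [|i s IH].
  by under eq_fun do rewrite big_nil; exact: cmeasurable_cst.
by under eq_fun do rewrite big_cons; exact: cmeasurableD.
Qed.

Lemma measurable_cmod_sq f : cmeasurable f ->
  measurable_fun setT (fun x => cmod (f x) ^+ 2).
Proof.
move=> [mf1 mf2]; under eq_fun do rewrite cmod_sq.
by apply: measurable_funD; exact: measurable_funX.
Qed.

(** Extended-valued, so that it can be bounded before [f] is known to lie in L2. Its real version
    [normsq] is meaningful only after that, because [fine] sends [+oo] to 0. *)
Definition sqint f : \bar R := (\int[mu]_x (cmod (f x) ^+ 2)%:E)%E.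
Definition normsq f : R := fine (sqint f).

Lemma sqint_ge0 f : (0 <= sqint f)%E.
Proof. by apply: integral_ge0 => x _; rewrite lee_fin sqr_ge0. Qed.

Lemma normsq_ge0 f : 0 <= normsq f.
Proof. by rewrite fine_ge0 ?sqint_ge0. Qed.

Lemma L2norm_sq f : (L2norm mu f ^+ 2 = sqint f)%E.
Proof.
rewrite /L2norm.
have h : (0 <= \int[mu]_x `|(cmod (f x))%:E| `^ 2)%E.
  by apply: integral_ge0 => x _; exact: poweR_ge0.
rewrite unlock poweR12_sqrt// sqr_sqrte//; apply: eq_integral => x _.
by rewrite /= powR_mulrn// ger0_norm ?cmod_ge0.
Qed.

Lemma Lfun2P (u : T -> R) : u \in Lfun mu 2%:E <->
  measurable_fun setT u /\ (\int[mu]_x (u x ^+ 2)%:E < +oo)%E.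
Proof.
have E : (\int[mu]_x (u x ^+ 2)%:E = Lnorm mu 2%:E (EFin \o u) `^ 2)%E.
  rewrite poweR_Lnorm//; apply: eq_integral => x _.
  by rewrite /= powR_mulrn// real_normK ?num_real.
rewrite E inE; split => [/andP[]|[mu1 h]].
  rewrite !inE/= => mu1 h; split => //.
  by apply: poweR_lty.
apply/andP; split; rewrite inE//=.
by rewrite /finite_norm; apply: lty_poweRy h.
Qed.

(** [sqint f] is the sum of the integrals of the squared real and imaginary parts; both are
    nonnegative, so the sum is finite exactly when each of them is. *)
Lemma L2P f : L2 mu f <-> cmeasurable f /\ (sqint f < +oo)%E.
Proof.
have E : cmeasurable f -> (sqint f = \int[mu]_x (complex.Re (f x) ^+ 2)%:E +
     \int[mu]_x (complex.Im (f x) ^+ 2)%:E)%E.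
  move=> [mf1 mf2]; rewrite -ge0_integralD//=.
  - by apply: eq_integral => x _; rewrite cmod_sq EFinD.
  - by move=> x _; rewrite lee_fin sqr_ge0.
  - by apply/measurable_EFinP; exact: measurable_funX.
  - by move=> x _; rewrite lee_fin sqr_ge0.
  - by apply/measurable_EFinP; exact: measurable_funX.
split=> [[/Lfun2P[mf1 h1] /Lfun2P[mf2 h2]]|[[mf1 mf2]]].
  by split => //; rewrite E// lte_add_pinfty.
rewrite E// => h; split; apply/Lfun2P; split => //; apply: le_lt_trans h.
  by rewrite leeDl// integral_ge0// => x _; rewrite lee_fin sqr_ge0.
by rewrite leeDr// integral_ge0// => x _; rewrite lee_fin sqr_ge0.
Qed.

Lemma L2_cmeasurable f : L2 mu f -> cmeasurable f.
Proof. by move=> /L2P[]. Qed.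

Lemma sqintE f : L2 mu f -> sqint f = (normsq f)%:E.
Proof.
by move=> /L2P[_ h]; rewrite /normsq fineK// ge0_fin_numE// sqint_ge0.
Qed.

Lemma sqint_le f h (k : R) : 0 <= k -> cmeasurable f -> cmeasurable h ->
  {ae mu, forall x, cmod (f x) ^+ 2 <= k * cmod (h x) ^+ 2} ->
  (sqint f <= k%:E * sqint h)%E.
Proof.
move=> k0 mf mh fh; rewrite -ge0_integralZl//=; last 2 first.
- by apply/measurable_EFinP; exact: measurable_cmod_sq.
- by move=> x _; rewrite lee_fin sqr_ge0.
apply: ae_ge0_le_integral => //=.
- by move=> x _; rewrite lee_fin sqr_ge0.
- by apply/measurable_EFinP; exact: measurable_cmod_sq.
- by move=> x _; rewrite lee_fin mulr_ge0// sqr_ge0.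
- apply/measurable_EFinP; apply: measurable_funM => //.
  exact: measurable_cmod_sq.
- by apply: filterS fh => x fhx _; rewrite lee_fin.
Qed.

Lemma L2_dominated f h (k : R) : 0 <= k -> cmeasurable f -> L2 mu h ->
  {ae mu, forall x, cmod (f x) ^+ 2 <= k * cmod (h x) ^+ 2} -> L2 mu f.
Proof.
move=> k0 mf /[dup] Lh /L2P[mh _] fh; apply/L2P; split => //.
apply: le_lt_trans (sqint_le k0 mf mh fh) _.
by rewrite sqintE// -EFinM ltry.
Qed.

Lemma L2_bounded f (k : R) : (mu setT < +oo)%E -> cmeasurable f ->
  (forall x, cmod (f x) ^+ 2 <= k) -> L2 mu f.
Proof.
move=> muT mf fk; apply/L2P; split => //.
apply: (@le_lt_trans _ _ (\int[mu]_x k%:E)%E).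
  apply: ge0_le_integral => //=.
  - by move=> x _; rewrite lee_fin sqr_ge0.
  - by apply/measurable_EFinP; exact: measurable_cmod_sq.
  - by move=> x _; rewrite lee_fin (le_trans _ (fk x))// sqr_ge0.
rewrite integral_cst//.
have muF : mu setT \is a fin_num by rewrite ge0_fin_numE.
by rewrite -(fineK muF) -EFinM ltry.
Qed.

Lemma sqintD f h : cmeasurable f -> cmeasurable h ->
  (sqint (fun x => (f x + h x)%R) <= 2%:E * sqint f + 2%:E * sqint h)%E.
Proof.
move=> mf mh; rewrite -!ge0_integralZl//=; last 4 first.
- by apply/measurable_EFinP; exact: measurable_cmod_sq.
- by move=> x _; rewrite lee_fin sqr_ge0.
- by apply/measurable_EFinP; exact: measurable_cmod_sq.
- by move=> x _; rewrite lee_fin sqr_ge0.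
have mc (u : T -> R[i]) : cmeasurable u ->
    measurable_fun setT (fun x => (2%:E * (cmod (u x) ^+ 2)%:E)%E).
  move=> mu1; apply/measurable_EFinP; apply: measurable_funM => //.
  exact: measurable_cmod_sq.
rewrite -ge0_integralD//=; last 4 first.
- by move=> x _; rewrite lee_fin mulr_ge0// sqr_ge0.
- exact: mc.
- by move=> x _; rewrite lee_fin mulr_ge0// sqr_ge0.
- exact: mc.
apply: ge0_le_integral => //=.
- by move=> x _; rewrite lee_fin sqr_ge0.
- by apply/measurable_EFinP/measurable_cmod_sq; exact: cmeasurableD.
- by apply: emeasurable_funD; exact: mc.
- by move=> x _; rewrite -!EFinM -EFinD lee_fin cmod_sqD.
Qed.

Lemma L2D f h : L2 mu f -> L2 mu h -> L2 mu (fun x => f x + h x).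
Proof.
move=> Lf Lh; apply/L2P; split; first by apply: cmeasurableD; exact: L2_cmeasurable.
apply: le_lt_trans (sqintD (L2_cmeasurable Lf) (L2_cmeasurable Lh)) _.
by rewrite (sqintE Lf) (sqintE Lh) -!EFinM -EFinD ltry.
Qed.

Lemma L2Z (k : R[i]) f : L2 mu f -> L2 mu (fun x => k * f x).
Proof.
move=> Lf; apply: (@L2_dominated _ f (cmod k ^+ 2)) => //.
- by rewrite sqr_ge0.
- apply: cmeasurableM; [exact: cmeasurable_cst|exact: L2_cmeasurable].
- by apply/nearW => x; rewrite cmod_sqM.
Qed.

Lemma L2B f h : L2 mu f -> L2 mu h -> L2 mu (fun x => f x - h x).
Proof.
by move=> Lf Lh; under eq_fun do rewrite -mulN1r; apply: L2D => //; exact: L2Z.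
Qed.

Lemma L2_0 : L2 mu (fun=> 0).
Proof.
apply/L2P; split; first exact: cmeasurable_cst.
by rewrite /sqint; under eq_integral do rewrite cmod0 expr0n; rewrite integral0.
Qed.

Lemma L2_sum (I : Type) (s : seq I) (F : I -> T -> R[i]) :
  (forall i, L2 mu (F i)) -> L2 mu (fun x => \sum_(i <- s) F i x).
Proof.
move=> mF; elim: s => [|i s IH].
  by under eq_fun do rewrite big_nil; exact: L2_0.
by under eq_fun do rewrite big_cons; exact: L2D.
Qed.

Lemma normsqD_le f h : L2 mu f -> L2 mu h ->
  normsq (fun x => f x + h x) <= 2 * normsq f + 2 * normsq h.
Proof.
move=> Lf Lh; rewrite -lee_fin -sqintE; last exact: L2D.
by rewrite EFinD !EFinM -!sqintE// sqintD//; exact: L2_cmeasurable.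
Qed.

Definition cintegrable f := mu.-integrable setT (fun x => (complex.Re (f x))%:E) /\
  mu.-integrable setT (fun x => (complex.Im (f x))%:E).

(** [L2dot mu f h] is convertible to [cint] of [f x * (h x)^*]; the laws of the inner product pass
    to this form and use linearity of the integral. *)
Definition cint f : R[i] :=
  Complex (\int[mu]_x complex.Re (f x)) (\int[mu]_x complex.Im (f x)).

Lemma eq_cint f h : f =1 h -> cint f = cint h.
Proof. by move=> /funext ->. Qed.

Lemma cintegrableM f h : L2 mu f -> L2 mu h -> cintegrable (fun x => f x * (h x)^*).
Proof.
move=> [f1 f2] [h1 h2]; split.
- rewrite (_ : (fun x => _) = fun x => ((complex.Re (f x) * complex.Re (h x))%:E +
     (complex.Im (f x) * complex.Im (h x))%:E)%E).
    by apply: integrableD => //; apply/Lfun1_integrable; exact: Lfun2_mul_Lfun1.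
  by apply/funext => x; rewrite -EFinD reM reJ imJ; congr EFin; ring.
- rewrite (_ : (fun x => _) = fun x => ((complex.Im (f x) * complex.Re (h x))%:E -
     (complex.Re (f x) * complex.Im (h x))%:E)%E).
    by apply: integrableB => //; apply/Lfun1_integrable; exact: Lfun2_mul_Lfun1.
  by apply/funext => x; rewrite -EFinB imM reJ imJ; congr EFin; ring.
Qed.

Lemma cintD f h : cintegrable f -> cintegrable h ->
  cint (fun x => f x + h x) = cint f + cint h.
Proof.
move=> [f1 f2] [h1 h2]; apply: eq_ReIm => /=.
- by under eq_Rintegral do rewrite reD; rewrite RintegralD.
- by under eq_Rintegral do rewrite imD; rewrite RintegralD.
Qed.

Lemma cintZ (k : R[i]) f : cintegrable f -> cint (fun x => k * f x) = k * cint f.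
Proof.
move=> [f1 f2].
have iZ (r : R) (u : T -> R) : mu.-integrable setT (fun x => (u x)%:E) ->
    mu.-integrable setT (fun x => (r * u x)%:E).
  by move=> iu; under eq_fun do rewrite EFinM; exact: integrableZl.
apply: eq_ReIm; rewrite ?reM ?imM/=.
- under eq_Rintegral do rewrite reM.
  by rewrite RintegralB ?RintegralZl//; exact: iZ.
- under eq_Rintegral do rewrite imM.
  by rewrite RintegralD ?RintegralZl//; exact: iZ.
Qed.

Lemma cintJ f : cintegrable f -> cint (fun x => (f x)^*) = (cint f)^*.
Proof.
move=> [f1 f2]; apply: eq_ReIm; rewrite ?reJ ?imJ/=.
- by under eq_Rintegral do rewrite reJ.
- by under eq_Rintegral do rewrite imJ -mulN1r; rewrite RintegralZl// mulN1r.
Qed.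

Local Notation dot := (L2dot mu).

Lemma L2dotD f1 f2 h : L2 mu f1 -> L2 mu f2 -> L2 mu h ->
  dot (fun x => f1 x + f2 x) h = dot f1 h + dot f2 h.
Proof.
move=> L1 L2 Lh; rewrite -[LHS]/(cint (fun x => (f1 x + f2 x) * (h x)^*)).
under eq_cint do rewrite mulrDl.
by rewrite cintD//; exact: cintegrableM.
Qed.

Lemma L2dotZ k f h : L2 mu f -> L2 mu h -> dot (fun x => k * f x) h = k * dot f h.
Proof.
move=> Lf Lh; rewrite -[LHS]/(cint (fun x => (k * f x) * (h x)^*)).
under eq_cint do rewrite -mulrA.
by rewrite cintZ//; exact: cintegrableM.
Qed.

Lemma L2dotJ f h : L2 mu f -> L2 mu h -> dot h f = (dot f h)^*.
Proof.
move=> Lf Lh; rewrite -[RHS]/((cint (fun x => f x * (h x)^*))^*).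
rewrite -cintJ; last exact: cintegrableM.
by apply: eq_cint => x; rewrite rmorphM/= conjCK mulrC.
Qed.

Lemma L2dotB f1 f2 h : L2 mu f1 -> L2 mu f2 -> L2 mu h ->
  dot (fun x => f1 x - f2 x) h = dot f1 h - dot f2 h.
Proof.
move=> L1 L2 Lh; under eq_fun do rewrite -mulN1r.
by rewrite L2dotD//; [rewrite L2dotZ// mulN1r|exact: L2Z].
Qed.

Lemma L2dot_sum (I : Type) (s : seq I) (F : I -> T -> R[i]) h :
  (forall i, L2 mu (F i)) -> L2 mu h ->
  dot (fun x => \sum_(i <- s) F i x) h = \sum_(i <- s) dot (F i) h.
Proof.
move=> LF Lh; elim: s => [|i s IH].
  rewrite big_nil; under eq_fun do rewrite big_nil.
  rewrite -[LHS]/(cint (fun x => 0 * (h x)^*)).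
  rewrite -[RHS](mul0r (dot (fun=> 0) h)) -L2dotZ//; last exact: L2_0.
  by apply: eq_cint => x; rewrite mul0r.
under eq_fun do rewrite big_cons.
by rewrite big_cons -IH L2dotD//; exact: L2_sum.
Qed.

Lemma L2dot_self f : L2 mu f -> dot f f = (normsq f)%:C.
Proof.
move=> Lf; rewrite -[LHS]/(cint (fun x => f x * (f x)^*)).
under eq_cint do rewrite mulcJ.
apply: eq_ReIm => //=.
by rewrite /Rintegral integral0.
Qed.

Lemma normsqD f h : L2 mu f -> L2 mu h ->
  normsq (fun x => f x + h x) = normsq f + normsq h + 2 * complex.Re (dot f h).
Proof.
move=> Lf Lh; apply: complexI; rewrite -L2dot_self; last exact: L2D.
have LD := L2D Lf Lh.
rewrite L2dotD// (L2dotJ LD Lf) (L2dotJ LD Lh) !L2dotD// !L2dot_self//.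
rewrite (L2dotJ Lf Lh); case: (dot f h) => a b.
by apply: eq_ReIm; rewrite /=; ring.
Qed.

Lemma normsqZ k f : L2 mu f -> normsq (fun x => k * f x) = cmod k ^+ 2 * normsq f.
Proof.
move=> Lf; apply: complexI; rewrite -L2dot_self; last exact: L2Z.
have LZ := L2Z k Lf.
rewrite L2dotZ// (L2dotJ LZ Lf) L2dotZ// L2dot_self// rmorphM/= mulrA mulcJ.
by apply: eq_ReIm; rewrite /=; ring.
Qed.

(** * Finite orthonormal expansions and Bessel's inequality *)

Section Orthonormal.
Variables (I : eqType) (e : I -> T -> R[i]).
Hypotheses (Le : forall i, L2 mu (e i))
  (oe : forall i j, dot (e i) (e j) = (i == j)%:R).

(** The list of indices is arbitrary because Bessel's inequality is needed both for the ranges -M..M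
    and for the finite sets that define [\esum]. *)
Definition fpart f (s : seq I) x := \sum_(i <- s) dot f (e i) * e i x.

Lemma L2_fpart f s : L2 mu (fpart f s).
Proof. by apply: L2_sum => i; exact: L2Z. Qed.

Lemma dot_fpart f s k : uniq s -> k \in s -> dot (fpart f s) (e k) = dot f (e k).
Proof.
move=> us ks; rewrite L2dot_sum//; last by move=> i; exact: L2Z.
rewrite (bigD1_seq k)//= L2dotZ// oe eqxx mulr1 big1 ?addr0// => i ik.
by rewrite L2dotZ// oe (negbTE ik) mulr0.
Qed.

Lemma normsq_fpart f s : uniq s ->
  normsq (fpart f s) = \sum_(i <- s) cmod (dot f (e i)) ^+ 2.
Proof.
move=> us; apply: complexI; rewrite -L2dot_self; last exact: L2_fpart.
rewrite L2dot_sum; [|by move=> i; exact: L2Z|exact: L2_fpart].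
rewrite rmorph_sum/= !big_seq; apply: eq_bigr => i si.
rewrite L2dotZ//; last exact: L2_fpart.
by rewrite (L2dotJ (L2_fpart _ _))// dot_fpart// mulcJ.
Qed.

(** Pythagoras: the residual is orthogonal to each [e i] with i in [s], hence to [fpart f s]. *)
Lemma normsq_sub_fpart f s : L2 mu f -> uniq s ->
  normsq (fun x => f x - fpart f s x) =
  normsq f - \sum_(i <- s) cmod (dot f (e i)) ^+ 2.
Proof.
move=> Lf us; have Lp := L2_fpart f s; have Ld := L2B Lf Lp.
have := normsqD Ld Lp; under eq_fun do rewrite subrK.
rewrite (normsq_fpart f us) => ->.
suff -> : dot (fun x => f x - fpart f s x) (fpart f s) = 0 by rewrite /=; ring.
rewrite (L2dotJ Lp Ld) L2dot_sum//; last by move=> i; exact: L2Z.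
rewrite big_seq big1 ?conjC0// => i si.
by rewrite L2dotZ// (L2dotJ Ld)// L2dotB// dot_fpart// subrr conjC0 mulr0.
Qed.

Lemma bessel f s : L2 mu f -> uniq s ->
  \sum_(i <- s) cmod (dot f (e i)) ^+ 2 <= normsq f.
Proof.
by move=> Lf us; rewrite -subr_ge0 -normsq_sub_fpart// normsq_ge0.
Qed.

Lemma fpartD f h s x : L2 mu f -> L2 mu h ->
  fpart (fun x => f x + h x) s x = fpart f s x + fpart h s x.
Proof.
move=> Lf Lh; rewrite /fpart -big_split; apply: eq_bigr => i _.
by rewrite L2dotD// mulrDl.
Qed.

Lemma fpartZ k f s x : L2 mu f -> fpart (fun x => k * f x) s x = k * fpart f s x.
Proof.
move=> Lf; rewrite /fpart big_distrr/=; apply: eq_bigr => i _.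
by rewrite L2dotZ// mulrA.
Qed.

End Orthonormal.

End L2.

(** * The trigonometric system on [0,1] *)

(** Lebesgue measure on [0,1] seen as a measure on all of R, so that functions stay total and
    measurability is over [setT]. *)
Definition lebesgue01 (R : realType) : probability (measurableTypeR R) R :=
  uniform_prob (@ltr01 R).

Section Fourier.
Context {R : realType}.
Local Notation nu := (lebesgue01 R).
Local Notation e := (@expfun R).

Lemma lebesgue01T :
  (nu : {measure set (measurableTypeR R) -> \bar R}) setT = 1%E.
Proof. exact: probability_setT. Qed.

Lemma expfunD j k t : e (j + k) t = e j t * e k t.
Proof.
rewrite /expfun intrD mulrDr mulrDl cosD sinD.
by apply: eq_ReIm; rewrite /= ; ring.
Qed.

Lemma expfun0 t : e 0 t = 1.
Proof. by rewrite /expfun mulr0 mul0r cos0 sin0. Qed.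

Lemma expfunJ j t : (e j t)^* = e (- j) t.
Proof. by rewrite /expfun mulrNz mulrN mulNr cosN sinN. Qed.

Lemma cmod_expfun j t : cmod (e j t) ^+ 2 = 1.
Proof. by rewrite cmod_sq/= cos2Dsin2. Qed.

Lemma continuous_linarg (k : R) : continuous (fun t : R => k * t).
Proof. by move=> x; apply: cvgMr; exact: cvg_id. Qed.

Lemma cmeasurable_expfun j : cmeasurable (e j : measurableTypeR R -> R[i]).
Proof.
split => /=; apply: continuous_measurable_fun => x.
- apply: continuous_comp; [exact: continuous_linarg|exact: continuous_cos].
- apply: continuous_comp; [exact: continuous_linarg|exact: continuous_sin].
Qed.

Lemma L2_expfun j : L2 nu (e j).
Proof.
apply: (@L2_bounded _ _ _ _ _ 1).
- by rewrite lebesgue01T ltry.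
- exact: cmeasurable_expfun.
- by move=> x; rewrite cmod_expfun.
Qed.

Lemma integral_nu (f : measurableTypeR R -> \bar R) : measurable_fun setT f ->
  (forall x, (0 <= f x)%E) ->
  (\int[nu]_x f x = \int[@lebesgue_measure R]_(x in `[0%R, 1%R]) f x)%E.
Proof. by move=> mf f0; rewrite integral_uniform// subr0 invr1 mul1e. Qed.

(* As [nu] is a probability, adding 1 to h makes the integrand nonnegative
   without losing information. *)
Lemma Rintegral_nu_primitive (h H : R -> R) : continuous h ->
  (forall x, `|h x| <= 1) -> (forall x : R, is_derive x 1 H (h x)) -> H 0 = H 1 ->
  \int[nu]_x h x = 0.
Proof.
move=> ch h1 dH H01.
have mh : measurable_fun setT (h : measurableTypeR R -> R).
  exact: continuous_measurable_fun.
have ih : nu.-integrable setT (EFin \o h).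
  apply: (@le_integrable _ _ _ nu _ measurableT _ (EFin \o cst 1)).
  - exact/measurable_EFinP.
  - by move=> x _ /=; rewrite lee_fin normr1.
  - exact: finite_measure_integrable_cst.
have i1 : nu.-integrable setT (EFin \o cst 1) by exact: finite_measure_integrable_cst.
have /(congr1 fine) : (\int[nu]_x (h x + 1)%:E = 1)%E.
  rewrite integral_nu.
  - pose F x := H x + x.
    have dF (x : R) : is_derive x 1 F (h x + 1).
      by apply: is_deriveD; exact: is_derive_id.
    have cF : continuous F.
      by move=> x; apply/differentiable_continuous/derivable1_diffP; have [] := dF x.
    rewrite (@continuous_FTC2 _ _ F)//.
    + by rewrite /F H01 -EFinB; congr EFin; ring.
    + apply: continuous_subspaceT => x; apply: cvgD; [exact: ch|exact: cvg_cst].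
    + split.
      * by move=> x _; have [] := dF x.
      * exact/cvg_at_right_filter/cF.
      * exact/cvg_at_left_filter/cF.
    + by move=> x _; rewrite derive1E derive_val.
  - by apply/measurable_EFinP; apply: measurable_funD.
  - move=> x; rewrite lee_fin; have := h1 x; rewrite ler_norml => /andP[? _].
    by rewrite -lerBlDr sub0r.
rewrite -/(Rintegral nu setT (fun x => h x + 1)) RintegralD//=.
rewrite Rintegral_cst//= probability_setT/= mulr1 => /(canRL (addrK _)) ->.
by rewrite subrr.
Qed.

Lemma nat2piE (n : nat) : 2 * pi * n%:R = 0 + pi *+ 2 *+ n :> R.
Proof. by rewrite add0r -(mulr_natr (pi *+ 2)) -(mulr_natl pi). Qed.

Lemma cos_int2pi (j : int) : cos (2 * pi * j%:~R) = 1 :> R.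
Proof.
case: j => n; first by rewrite nat2piE (periodicn (@cosD2pi R)) cos0.
by rewrite NegzE mulrNz mulrN cosN nat2piE (periodicn (@cosD2pi R)) cos0.
Qed.

Lemma sin_int2pi (j : int) : sin (2 * pi * j%:~R) = 0 :> R.
Proof.
case: j => n; first by rewrite nat2piE (periodicn (@sinD2pi R)) sin0.
by rewrite NegzE mulrNz mulrN sinN nat2piE (periodicn (@sinD2pi R)) sin0 oppr0.
Qed.

(** For nonzero j the real and imaginary parts have the primitives sin(kx)/k and -cos(kx)/k with k =
    2 pi j, and these take equal values at 0 and 1. *)
Lemma cint_expfun j : cint nu (e j) = (j == 0)%:R.
Proof.
have [->|j0] := eqVneq.
  under eq_cint do rewrite expfun0.
  apply: eq_ReIm => /=; rewrite Rintegral_cst//= ?mul0r//.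
  by rewrite lebesgue01T/= mulr1.
have k0 : 2 * pi * j%:~R != 0 :> R.
  by rewrite !mulf_neq0// ?intr_eq0// gt_eqF// pi_gt0.
set k := _ * _ in k0.
have dk (x : R) : is_derive x 1 (fun x => k * x) k.
  have := @is_deriveZ R R R id k x 1 1 (is_derive_id _ _).
  by rewrite /GRing.scale/= mulr1.
apply: eq_ReIm => /=.
- apply: (@Rintegral_nu_primitive _ (fun x => k^-1 * sin (k * x))).
  + by move=> x; apply: continuous_comp;
      [exact: continuous_linarg|exact: continuous_cos].
  + by move=> x; exact: cos_max.
  + move=> x.
    have D := @is_deriveZ R R R (fun x => sin (k * x)) k^-1 x 1 _
      (is_derive1_comp (is_derive_sin _) (dk x)).
    apply: (is_derive_eq D).
    by rewrite /GRing.scale/= mulrA mulrAC mulVf ?mul1r.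
  + by rewrite !mulr0 mulr1 sin0 sin_int2pi.
- apply: (@Rintegral_nu_primitive _ (fun x => - k^-1 * cos (k * x))).
  + by move=> x; apply: continuous_comp;
      [exact: continuous_linarg|exact: continuous_sin].
  + by move=> x; exact: sin_max.
  + move=> x.
    have D := @is_deriveZ R R R (fun x => cos (k * x)) (- k^-1) x 1 _
      (is_derive1_comp (is_derive_cos _) (dk x)).
    apply: (is_derive_eq D).
    by rewrite /GRing.scale/=; field.
  + by rewrite !mulr0 mulr1 cos0 cos_int2pi.
Qed.

Lemma expfun_orthonormal i j : L2dot nu (e i) (e j) = (i == j)%:R.
Proof.
rewrite -[LHS]/(cint nu (fun x => e i x * (e j x)^*)).
under eq_cint do rewrite expfunJ -expfunD.
by rewrite cint_expfun subr_eq0.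
Qed.
End Fourier.

(** * Fourier sums *)

Section SymmetricIndices.

Definition symidx (M : nat) : seq int :=
  [seq (i : nat)%:Z - M%:Z | i <- iota 0 M.*2.+1].

Lemma symsumE (R : realType) (F : int -> R[i]) M :
  symsum F M = \sum_(j <- symidx M) F j.
Proof.
rewrite /symidx big_map -[X in iota _ X]subn0 -/(index_iota 0 _).
by rewrite (big_mkord xpredT (fun i => F (i%:Z - M%:Z))).
Qed.

Lemma symidx_uniq M : uniq (symidx M).
Proof. by rewrite map_inj_uniq ?iota_uniq// => i j /addIr[]. Qed.

Lemma mem_symidx M (j : int) : (j \in symidx M) = (`|j| <= M)%N.
Proof.
apply/mapP/idP => [[k]|jM].
  by rewrite mem_iota => /andP[_ kM] ->; lia.
exists (absz (j + M%:Z)); first by rewrite mem_iota; lia.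
by lia.
Qed.

Lemma sum_symidxS (V : zmodType) (F : int -> V) M :
  \sum_(j <- symidx M.+1) F j =
  F (- M.+1%:Z) + \sum_(j <- symidx M) F j + F M.+1%:Z.
Proof.
have p : perm_eq (symidx M.+1) (- M.+1%:Z :: rcons (symidx M) M.+1%:Z).
  apply: uniq_perm; first exact: symidx_uniq.
    rewrite cons_uniq rcons_uniq symidx_uniq andbT mem_rcons in_cons !mem_symidx; lia.
  by move=> j; rewrite [RHS]in_cons mem_rcons [in RHS]in_cons !mem_symidx; lia.
by rewrite (perm_big _ p) big_cons big_rcons/= addrA.
Qed.

Lemma sum_symidx0 (V : zmodType) (F : int -> V) : \sum_(j <- symidx 0) F j = F 0.
Proof. by rewrite /symidx/= big_seq1. Qed.

Lemma telescope_symidx (V : zmodType) (H : int -> V) M :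
  \sum_(j <- symidx M) (H (j - 1) - H j) = H (- M.+1%:Z) - H M%:Z.
Proof.
elim: M => [|M IH]; first by rewrite sum_symidx0.
rewrite sum_symidxS IH.
have -> : - M.+1%:Z - 1 = - M.+2%:Z by lia.
have -> : M.+1%:Z - 1 = M%:Z by lia.
by rewrite [X in X + _]addrA subrK addrA subrK.
Qed.

End SymmetricIndices.

Section Fourier.
Context {R : realType}.
Local Notation nu :=
  (lebesgue01 R : {measure set (measurableTypeR R) -> \bar R}).
Local Notation e := (@expfun R).
Local Notation T := (measurableTypeR R).
Implicit Types f h F G : T -> R[i].

Definition fcoef f j := L2dot nu f (e j).
Definition fsum f M := fpart nu e f (symidx M).
Definition energy f M := \sum_(j <- symidx M) cmod (fcoef f j) ^+ 2.

Lemma energyS f M : energy f M.+1 =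
  cmod (fcoef f (- M.+1%:Z)) ^+ 2 + energy f M + cmod (fcoef f M.+1%:Z) ^+ 2.
Proof. exact: sum_symidxS. Qed.

Lemma energy_nd f : {homo energy f : m n / (m <= n)%N >-> m <= n}.
Proof.
apply/nondecreasing_seqP => M; rewrite energyS.
by rewrite -addrA addrCA lerDl addr_ge0// sqr_ge0.
Qed.

Lemma energy_le f M : L2 nu f -> energy f M <= normsq nu f.
Proof.
by move=> Lf; apply: bessel => //;
  [exact: L2_expfun|exact: expfun_orthonormal|exact: symidx_uniq].
Qed.

Lemma normsq_fsum f M : normsq nu (fsum f M) = energy f M.
Proof.
by apply: normsq_fpart;
  [exact: L2_expfun|exact: expfun_orthonormal|exact: symidx_uniq].
Qed.

Lemma L2_fsum f M : L2 nu (fsum f M).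
Proof. by apply: L2_fpart; exact: L2_expfun. Qed.

Lemma normsq_sub_fsum f M : L2 nu f ->
  normsq nu (fun x => f x - fsum f M x) = normsq nu f - energy f M.
Proof.
by move=> Lf; apply: normsq_sub_fpart => //;
  [exact: L2_expfun|exact: expfun_orthonormal|exact: symidx_uniq].
Qed.

Lemma energy_cvg f : L2 nu f -> cvgn (energy f).
Proof.
move=> Lf; apply: nondecreasing_is_cvgn; first exact: energy_nd.
by exists (normsq nu f) => _ [M _ <-]; exact: energy_le.
Qed.

(** Riemann-Lebesgue out of Bessel: the energies are monotone and bounded, hence converge, and the
    quantity here is their increment from M to M+1. *)
Lemma fcoef_cvg0 f : L2 nu f ->
  (fun M : nat => cmod (fcoef f (- M.+1%:Z)) ^+ 2 + cmod (fcoef f M.+1%:Z) ^+ 2)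
    @ \oo --> 0.
Proof.
move=> Lf; have /cvg_ex[l El] := energy_cvg Lf.
rewrite (_ : (fun M : nat => _) = (fun M => energy f (M + 1)%N - energy f M)).
  by rewrite -(subrr l); apply: cvgB => //; rewrite cvg_shiftn.
by apply/funext => M; rewrite addn1 energyS; ring.
Qed.

Lemma L2dot_ae f1 f2 h : {ae nu, forall x, f1 x = f2 x} ->
  L2 nu f1 -> L2 nu f2 -> L2 nu h -> L2dot nu f1 h = L2dot nu f2 h.
Proof.
move=> f12 L1 L2 Lh.
have [i1 i2] := cintegrableM L1 Lh; have [j1 j2] := cintegrableM L2 Lh.
apply: eq_ReIm => /=; congr fine; apply: ae_eq_integral => //.
- exact: measurable_int i1.
- exact: measurable_int j1.
- by apply: filterS f12 => x -> _.
- exact: measurable_int i2.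
- exact: measurable_int j2.
- by apply: filterS f12 => x -> _.
Qed.

Lemma ae_nu01 : {ae nu, forall x : T, 0 <= (x : R) <= 1}.
Proof.
exists (~` `[0, 1]); split; first exact: measurableC.
- rewrite /= /lebesgue01 /uniform_prob/= integral_uniform_pdf.
  by rewrite setICl integral_set0.
- by move=> x /= h; rewrite in_itv.
Qed.

Lemma ae_nu_neq (y : R) : {ae nu, forall x : T, x != y :> R}.
Proof.
exists [set y]; split => //.
- have : lebesgue01 R `<< @lebesgue_measure R by exact: dominates_uniform_prob.
  by move=> /null_content_dominatesP; apply => //; exact: lebesgue_measure_set1.
- by move=> x /= /negP; rewrite negbK => /eqP.
Qed.

(** Multiplication by [e 1] shifts the coefficients, as e_1 times the conjugate of e_j is the
    conjugate of e_(j-1). *)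
Lemma fcoef_mul G x j : L2 nu G ->
  L2dot nu (fun y => (e 1 y - e 1 x) * G y) (e j) =
  fcoef G (j - 1) - e 1 x * fcoef G j.
Proof.
move=> LG; under eq_fun do rewrite mulrBl.
have LeG : L2 nu (fun y => e 1 y * G y).
  apply: (@L2_dominated _ _ _ _ _ G 1) => //.
  - by apply: cmeasurableM; [exact: cmeasurable_expfun|exact: L2_cmeasurable LG].
  - by apply/nearW => y; rewrite cmod_sqM cmod_expfun !mul1r.
rewrite L2dotB ?L2dotZ//; [|exact: L2_expfun|exact: L2Z|exact: L2_expfun].
congr (_ - _); apply: eq_cint => y.
rewrite !expfunJ mulrAC mulrC -expfunD; congr (_ * e _ _); lia.
Qed.

(* Chernoff's argument: dividing F - F x by e_1 - e_1 x turns the partial sum at x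
   into a telescoping sum. *)
Lemma fsum_telescope F G x : L2 nu F -> L2 nu G ->
  {ae nu, forall y, F y = F x + (e 1 y - e 1 x) * G y} ->
  forall M, fsum F M x - F x =
   fcoef G (- M.+1%:Z) * e (- M.+1%:Z + 1) x - fcoef G M%:Z * e (M%:Z + 1) x.
Proof.
move=> LF LG FG M.
have Lc : L2 nu (fun=> F x).
  apply: (@L2_bounded _ _ _ _ _ (cmod (F x) ^+ 2)) => //.
  by rewrite lebesgue01T ltry.
have LeG : L2 nu (fun y => (e 1 y - e 1 x) * G y).
  (* The constant 4 is 2 + 2, from [cmod_sqB] and two exponentials of modulus 1. *)
  apply: (@L2_dominated _ _ _ _ _ G 4) => //.
  - apply: cmeasurableM; last exact: L2_cmeasurable LG.
    by apply: cmeasurableD; [exact: cmeasurable_expfun|exact: cmeasurable_cst].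
  - apply/nearW => y; rewrite cmod_sqM ler_wpM2r ?sqr_ge0//.
    by apply: le_trans (cmod_sqB _ _) _; rewrite !cmod_expfun; lra.
(* The constant F(x), written as a multiple of [e 0], contributes only to coefficient 0. *)
have E j : fcoef F j = F x * (j == 0)%:R + (fcoef G (j - 1) - e 1 x * fcoef G j).
  rewrite /fcoef (L2dot_ae FG)//; [|exact: L2D|exact: L2_expfun].
  rewrite L2dotD//; last exact: L2_expfun.
  rewrite fcoef_mul//; congr (_ + _).
  transitivity (L2dot nu (fun y => F x * e 0 y) (e j)).
    by apply: eq_cint => y; rewrite expfun0 mulr1.
  rewrite L2dotZ ?expfun_orthonormal; [|exact: L2_expfun..].
  by rewrite eq_sym.
rewrite /fsum /fpart.
under eq_bigr do rewrite -/(fcoef F _) E mulrDl.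
rewrite big_split/= (bigD1_seq 0) ?mem_symidx ?symidx_uniq//= big1 ?addr0; last first.
  by move=> j j0; rewrite (negbTE j0) mulr0 mul0r.
rewrite ?eqxx mulr1 expfun0 mulr1 [X in X - _]addrC addrK.
(* Since e_1(x) e_j(x) = e_(j+1)(x), the j-th term is H(j-1) - H(j) with H(j) = G^(j) e_(j+1)(x),
   and only the two ends survive. *)
rewrite -(telescope_symidx (fun j => fcoef G j * e (j + 1) x)).
apply: eq_bigr => j _; rewrite subrK mulrBl expfunD; ring.
Qed.

(** * Pointwise convergence of Fourier sums *)

Lemma cvg0_squeeze (u v : nat -> R) : (forall n, 0 <= u n <= v n) ->
  v @ \oo --> 0 -> u @ \oo --> 0.
Proof.
move=> uv v0; apply: (squeeze_cvgr _ (cvg_cst 0) v0).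
by apply/nearW.
Qed.

Lemma fsum_cvg_of_quotient F G x : L2 nu F -> L2 nu G ->
  {ae nu, forall y, F y = F x + (e 1 y - e 1 x) * G y} ->
  (fun M => cmod (fsum F M x - F x) ^+ 2) @ \oo --> 0.
Proof.
(* At M = n+1 the surviving coefficients of G have indices -(n+2) and n+1; they occur in [w n.+1]
   and [w n] respectively. *)
move=> LF LG FG; rewrite -cvg_shiftS /=.
pose w n : R := cmod (fcoef G (- n.+1%:Z)) ^+ 2 + cmod (fcoef G n.+1%:Z) ^+ 2.
have w0 : w @ \oo --> 0 by exact: fcoef_cvg0.
apply: (@cvg0_squeeze _ (fun n => 2 * w n.+1 + 2 * w n)).
  move=> n; rewrite sqr_ge0/= (fsum_telescope LF LG FG).
  apply: le_trans (cmod_sqB _ _) _; rewrite !cmod_sqM !cmod_expfun !mulr1 /w.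
  have := sqr_ge0 (cmod (fcoef G n.+2%:Z)).
  have := sqr_ge0 (cmod (fcoef G (- n.+1%:Z))).
  by lra.
rewrite -[0 in X in _ --> X](addr0 0) -[in X in _ --> X](mulr0 2).
by apply: cvgD; apply: cvgMr => //; rewrite cvg_shiftS.
Qed.

Lemma cmod_sq_expfunB x y :
  cmod (e 1 y - e 1 x) ^+ 2 = 2 - 2 * cos (2 * pi * `|y - x|).
Proof.
rewrite cmod_sq/= !mulr1.
have -> : cos (2 * pi * `|y - x|) = cos (2 * pi * y - 2 * pi * x).
  rewrite -mulrBr -cos_norm -[RHS]cos_norm !normrM normr_id//.
rewrite cosB.
have := cos2Dsin2 (2 * pi * x); have := cos2Dsin2 (2 * pi * y).
set a := cos _; set b := sin _; set c := cos _; set d := sin _.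
nra.
Qed.

(** Replacing t by 1 - t leaves the cosine unchanged and brings t into [rho, 1/2], where cos(2 pi t)
    decreases. *)
Lemma cos_le_gap (rho t : R) : 0 < rho -> rho <= t <= 1 - rho ->
  cos (2 * pi * t) <= cos (2 * pi * rho).
Proof.
move=> r0 /andP[rt tr]; have p0 : 0 < pi :> R := pi_gt0 R.
wlog t2 : t rt tr / t <= 1/2.
  move=> H; have [|t2] := leP t (1/2); first exact: H.
  have -> : cos (2 * pi * t) = cos (2 * pi * (1 - t)).
    rewrite -[LHS]cosN -(cosD2pi (- _)); congr cos; rewrite -mulr_natl; ring.
  by apply: H; lra.
move: rt; rewrite le_eqVlt => /orP[/eqP->//|rt]; apply: ltW.
rewrite ltr_cos ?in_itv/= ?ltr_pM2l//; first by nra.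
- by apply/andP; split; nra.
- by apply/andP; split; nra.
Qed.

(** If F differs from F(x) only away from x, the quotient in Chernoff's argument is dominated by a
    multiple of F - F(x). Distance is that of the circle, where 0 and 1 coincide; this is why |y -
    x| must also stay below 1 - rho. *)
Lemma fsum_cvg_of_gap F x (rho : R) : L2 nu F -> 0 < rho <= 1/2 ->
  (forall y : R, 0 <= y <= 1 -> F y != F x -> rho <= `|y - x| <= 1 - rho) ->
  (fun M => cmod (fsum F M x - F x) ^+ 2) @ \oo --> 0.
Proof.
move=> LF /andP[r0 r2] gap; have p0 : 0 < pi :> R := pi_gt0 R.
(* The squared chord of the circle at distance rho: a lower bound for |e_1(y) - e_1(x)|^2 wherever y
   in [0,1] has F(y) different from F(x). *)
pose dl : R := 2 - 2 * cos (2 * pi * rho).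
have dl0 : 0 < dl.
  have pr0 : 0 < 2 * pi * rho by rewrite mulr_gt0// mulr_gt0.
  have prpi : 2 * pi * rho <= pi by nra.
  rewrite subr_gt0 gtr_pMr// -[ltRHS](@cos0 R).
  by rewrite ltr_cos ?in_itv/= ?lexx ?pi_ge0// ?(ltW pr0).
pose q y := cmod (e 1 y - e 1 x) ^+ 2.
(* Truncation at [dl] bounds the reciprocal everywhere; for y in [0,1] it changes the value only
   where F(y) = F(x). The inverse is written as a power to obtain its measurability. *)
pose k y := (Num.max (q y) dl) `^ (- 1).
have me1 : cmeasurable (fun y : T => e 1 y - e 1 x).
  by apply: cmeasurableD; [exact: cmeasurable_expfun|exact: cmeasurable_cst].
have mk : measurable_fun setT (k : T -> R).
  apply: (@measurableT_comp _ _ _ _ _ _ (fun z : R => z `^ (- 1))) => //.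
  by apply: measurable_maxr => //; exact: measurable_cmod_sq.
have k0 y : 0 <= k y by exact: powR_ge0.
have mx0 y : 0 < Num.max (q y) dl by rewrite lt_max dl0 orbT.
have kE y : k y = (Num.max (q y) dl)^-1 by rewrite /k powR_inv1// ltW.
have Lc : L2 nu (fun y => F y - F x).
  apply: L2B => //; apply: (@L2_bounded _ _ _ _ _ (cmod (F x) ^+ 2)) => //.
  by rewrite lebesgue01T ltry.
pose G (y : T) := (k y)%:C * ((e 1 y - e 1 x)^* * (F y - F x)).
apply: (@fsum_cvg_of_quotient _ G) => //.
  apply: (@L2_dominated _ _ _ _ _ (fun y => F y - F x) dl^-1) => //.
  - by rewrite invr_ge0 ltW.
  - apply: cmeasurableM; first exact: cmeasurable_real.
    apply: cmeasurableM; last exact: L2_cmeasurable Lc.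
    exact: cmeasurableJ.
  - apply/nearW => y; rewrite !cmod_sqM cmod_sqJ mulrA ler_wpM2r ?sqr_ge0//.
    rewrite -/(q y) cmod_sq/= expr0n addr0 kE.
    apply: (@le_trans _ _ (Num.max (q y) dl)^-1).
      rewrite expr2 -mulrA ler_piMr ?invr_ge0 ?(ltW (mx0 y))//.
      by rewrite mulrC ler_pdivrMr// mul1r le_max lexx.
    by rewrite lef_pV2 ?posrE// le_max lexx orbT.
have := ae_nu01; apply: filterS => y y01.
suff -> : (e 1 y - e 1 x) * G y = F y - F x by rewrite addrC subrK.
rewrite /G; have [->|FyFx] := eqVneq (F y) (F x); first by rewrite subrr !mulr0.
have qdl : dl <= q y.
  rewrite /q cmod_sq_expfunB /dl lerB// ler_pM2l//.
  exact: cos_le_gap (gap _ y01 FyFx).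
transitivity ((k y)%:C * ((e 1 y - e 1 x) * (e 1 y - e 1 x)^*) * (F y - F x)).
  by ring.
rewrite mulcJ -/(q y) -rmorphM/= kE max_l// mulVf ?rmorph1 ?mul1r//.
by rewrite gt_eqF// (lt_le_trans dl0).
Qed.

End Fourier.

(** * Completeness *)

Section CmodLimits.
Context {R : realType}.

Lemma cmodE (z : R[i]) : (cmod z)%:C = `|z|.
Proof. by rewrite /cmod normc_def. Qed.

Lemma cmodD (z w : R[i]) : cmod (z + w) <= cmod z + cmod w.
Proof. by rewrite -lecR rmorphD/= !cmodE ler_normD. Qed.

Lemma cmod_real (x : R) : cmod x%:C ^+ 2 = x ^+ 2.
Proof. by rewrite cmod_sq/= expr0n addr0. Qed.

Lemma sqr_cvg0 (u : nat -> R) : (forall n, 0 <= u n) ->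
  (fun n => u n ^+ 2) @ \oo --> 0 -> u @ \oo --> 0.
Proof.
move=> u0 h; rewrite (_ : u = fun n => Num.sqrt (u n ^+ 2)); last first.
  by apply/funext => n; rewrite sqrtr_sqr ger0_norm.
rewrite -[0 in X in _ --> X](@sqrtr0 R).
by apply: continuous_cvg h; exact: sqrt_continuous.
Qed.

Lemma ge0_cvg0P (u : nat -> R) : (forall n, 0 <= u n) ->
  u @ \oo --> 0 <-> forall eps, 0 < eps -> \forall n \near \oo, u n <= eps.
Proof.
move=> u0; split=> [/cvgr0Pnorm_le h eps /h|h].
  by apply: filterS => n; rewrite ger0_norm.
apply/cvgr0Pnorm_le => eps /h.
by apply: filterS => n; rewrite ger0_norm.
Qed.

Lemma cvg_EFin_seq (u : nat -> R) (l : R) :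
  u @ \oo --> l -> (fun n => (u n)%:E) @ \oo --> l%:E.
Proof. by move=> ul; apply: cvg_EFin; first exact: nearW. Qed.

Lemma cmod_sq_cvg (z_ : nat -> R[i]) (z : R[i]) :
  (fun n => cmod (z_ n - z) ^+ 2) @ \oo --> 0 ->
  (fun n => cmod (z_ n) ^+ 2) @ \oo --> cmod z ^+ 2.
Proof.
move=> h; have h1 : (fun n => cmod (z_ n - z)) @ \oo --> 0.
  by apply: sqr_cvg0 => // n; exact: cmod_ge0.
suff h2 : (fun n => cmod (z_ n)) @ \oo --> cmod z.
  by rewrite expr2; apply: cvgM.
apply: (@squeeze_cvgr _ _ _ _ (fun n => cmod z - cmod (z_ n - z))
  (fun n => cmod z + cmod (z_ n - z))).
- apply: nearW => n; apply/andP; split.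
    rewrite lerBlDr (_ : cmod (z_ n - z) = cmod (z - z_ n)).
      by rewrite -[X in cmod X <= _](subrKC (z_ n)) cmodD.
    by rewrite /cmod distrC.
  by rewrite -[X in cmod X <= _](subrKC z) cmodD.
- rewrite -[X in _ --> X]subr0; apply: cvgB => //; exact: cvg_cst.
- rewrite -[X in _ --> X]addr0; apply: cvgD => //; exact: cvg_cst.
Qed.

End CmodLimits.

Section Completeness.
Context {R : realType}.
Local Notation nu :=
  (lebesgue01 R : {measure set (measurableTypeR R) -> \bar R}).
Local Notation e := (@expfun R).
Local Notation T := (measurableTypeR R).
Implicit Types f h F G : T -> R[i].

Definition parseval f := L2 nu f /\ energy f @ \oo --> normsq nu f.

Lemma parsevalP f : L2 nu f ->
  parseval f <-> (fun M => normsq nu (fun x => f x - fsum f M x)) @ \oo --> 0.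
Proof.
move=> Lf; under eq_fun do rewrite normsq_sub_fsum//.
split=> [[_ h]|h].
  by rewrite -(subrr (normsq nu f)); apply: cvgB => //; exact: cvg_cst.
split => //.
rewrite (_ : energy f = fun M => normsq nu f - (normsq nu f - energy f M)).
  by rewrite -[X in _ --> X]subr0; apply: cvgB => //; exact: cvg_cst.
by apply/funext => M; rewrite subKr.
Qed.

(** The Parseval class is closed in L2: the residual of f splits into those of f - h and of h, and
    by Bessel the first is at most the norm of f - h. Each squared residual gets eps/4 because the
    splitting doubles both. *)
Lemma parseval_approx f : L2 nu f ->
  (forall eps : R, 0 < eps ->
    exists h, parseval h /\ normsq nu (fun x => f x - h x) <= eps) ->
  parseval f.
Proof.
move=> Lf H; apply/parsevalP => //; apply/ge0_cvg0P => [M|eps eps0].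
  exact: normsq_ge0.
have eps4 : 0 < eps / 4 by rewrite divr_gt0.
have [h [Ph fh]] := H _ eps4; have Lh := Ph.1.
have /ge0_cvg0P := (parsevalP Lh).1 Ph.
move=> /(_ (fun=> normsq_ge0 _ _) _ eps4); apply: filterS => M hM.
have Lfh : L2 nu (fun x => f x - h x) by exact: L2B.
rewrite (_ : (fun x => f x - fsum f M x) = fun x =>
   ((f x - h x) - fsum (fun x => f x - h x) M x) + (h x - fsum h M x)).
  have h1 : normsq nu
      (fun x => (f x - h x) - fsum (fun x => f x - h x) M x) <= eps / 4.
    rewrite normsq_sub_fsum// (le_trans _ fh)// lerBlDr lerDl.
    by apply: sumr_ge0 => j _; rewrite sqr_ge0.
  apply: le_trans (normsqD_le (L2B Lfh (L2_fsum _ _)) (L2B Lh (L2_fsum _ _))) _.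
  have -> : eps = 2 * (eps / 4) + 2 * (eps / 4) by field.
  exact: lerD (ler_wpM2l (ler0n _ 2) h1) (ler_wpM2l (ler0n _ 2) hM).
apply/funext => x.
rewrite -[in fsum f M x](_ : (fun x => (f x - h x) + h x) = f); last first.
  by apply/funext => y; rewrite subrK.
rewrite /fsum fpartD//; last exact: L2_expfun.
by rewrite opprD; ring.
Qed.

Lemma parsevalD f h : parseval f -> parseval h -> parseval (fun x => f x + h x).
Proof.
move=> [Lf Pf] [Lh Ph]; apply/parsevalP; first exact: L2D.
apply: (@cvg0_squeeze _ _ (fun M => 2 * normsq nu (fun x => f x - fsum f M x) +
    2 * normsq nu (fun x => h x - fsum h M x))).
  move=> M; rewrite normsq_ge0/=.
  have -> : (fun x => f x + h x - fsum (fun x => f x + h x) M x) =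
      fun x => (f x - fsum f M x) + (h x - fsum h M x).
    apply/funext => x; rewrite /fsum fpartD//; last exact: L2_expfun.
    by rewrite opprD; ring.
  exact: normsqD_le (L2B Lf (L2_fsum _ _)) (L2B Lh (L2_fsum _ _)).
rewrite -[0 in X in _ --> X](addr0 0) -[in X in _ --> X](mulr0 2).
by apply: cvgD; apply: cvgMr; apply/parsevalP.
Qed.

Lemma parsevalZ k f : parseval f -> parseval (fun x => k * f x).
Proof.
move=> [Lf Pf]; apply/parsevalP; first exact: L2Z.
rewrite (_ : (fun M => _) =
    fun M => cmod k ^+ 2 * normsq nu (fun x => f x - fsum f M x)).
  rewrite -[0 in X in _ --> X](mulr0 (cmod k ^+ 2)).
  by apply: cvgMr; apply/parsevalP.
apply/funext => M; rewrite -normsqZ; last by apply: L2B => //; exact: L2_fsum.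
congr normsq; apply/funext => x; rewrite /fsum fpartZ//; last exact: L2_expfun.
by rewrite mulrBr.
Qed.

(* Fatou gives [normsq nu F <= lim energy], Bessel the converse. *)
Lemma parseval_of_ae_cvg F : L2 nu F ->
  {ae nu, forall x, (fun M => cmod (fsum F M x - F x) ^+ 2) @ \oo --> 0} ->
  parseval F.
Proof.
move=> LF cF; split => //.
have /cvg_ex[l El] := energy_cvg LF.
suff : normsq nu F = l by move=> ->.
apply/eqP; rewrite eq_le; apply/andP; split; last first.
  rewrite -(cvg_lim _ El)//; apply: limr_le; first by apply/cvg_ex; exists l.
  by apply: nearW => M; exact: energy_le.
rewrite -lee_fin -sqintE//.
have mS M : measurable_fun setT (fun x : T => (cmod (fsum F M x) ^+ 2)%:E).
  by apply/measurable_EFinP/measurable_cmod_sq/L2_cmeasurable/L2_fsum.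
have El' : (fun M => (energy F M)%:E) @ \oo --> l%:E by exact: cvg_EFin_seq.
(* Energies are the squared norms of the partial sums, so their limit is the larger side of Fatou's
   inequality. *)
have -> : l%:E = limn_einf (fun M => sqint nu (fsum F M)).
  rewrite (_ : (fun M => _) = fun M => (energy F M)%:E).
    rewrite is_cvg_limn_einfE; last by apply/cvg_ex; exists l%:E.
    by rewrite (cvg_lim _ El').
  by apply/funext => M; rewrite sqintE ?normsq_fsum//; exact: L2_fsum.
apply: le_trans (fatou _ measurableT mS _); last first.
  by move=> M x _; rewrite lee_fin sqr_ge0.
(* Almost everywhere the squared moduli of the partial sums converge to that of F, so their lower
   limit integrates to the squared norm of F. *)
rewrite le_eqVlt; apply/orP; left; apply/eqP; apply: ge0_ae_eq_integral => //=.
- by apply/measurable_EFinP; exact: measurable_cmod_sq (L2_cmeasurable LF).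
- rewrite (_ : (fun x => _) = fun x =>
      (- limn_esup (fun n => - (cmod (fsum F n x) ^+ 2)%:E))%E).
    apply: measurableT_comp => //; apply: measurable_fun_limn_esup => n.
    exact: measurableT_comp.
  apply/funext => x; rewrite -limn_einfN; congr limn_einf.
  by apply/funext => n /=; rewrite opprK.
- by move=> x _; rewrite lee_fin sqr_ge0.
- move=> x _; rewrite limn_einf_lim; apply: lime_ge; first exact: is_cvg_einfs.
  apply: nearW => M; apply: le_ereal_inf_tmp => _ [k _ <-].
  by rewrite lee_fin sqr_ge0.
- apply: filterS cF => x cFx _.
  have h := cvg_EFin_seq (cmod_sq_cvg cFx).
  rewrite is_cvg_limn_einfE; last by apply/cvg_ex; eexists; exact: h.
  by rewrite (cvg_lim _ h).
Qed.

Lemma parseval_cst (k : R[i]) : parseval (fun=> k).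
Proof.
have Lk : L2 nu (fun=> k).
  by apply: (@L2_bounded _ _ _ _ _ (cmod k ^+ 2)) => //; rewrite lebesgue01T ltry.
apply: parseval_of_ae_cvg => //; apply/nearW => x.
(* The gap condition is vacuous for a constant, so any admissible radius serves. *)
apply: (@fsum_cvg_of_gap _ (fun=> k) _ (1/2)) => //; first by lra.
by move=> y _; rewrite eqxx.
Qed.

Lemma parseval_sum (I : Type) (s : seq I) (F : I -> T -> R[i]) :
  (forall i, parseval (F i)) -> parseval (fun x => \sum_(i <- s) F i x).
Proof.
move=> mF; elim: s => [|i s IH].
  by under eq_fun do rewrite big_nil; exact: parseval_cst.
by under eq_fun do rewrite big_cons; exact: parsevalD.
Qed.

(** On the circle this indicator can jump only at a and at the point 0 = 1; at every other x of
    [0,1] the gap criterion applies. *)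
Lemma parseval_itv (a : R) : parseval (fun x => (\1_(`]a, +oo[) x)%:C).
Proof.
set F := fun x : T => _.
have LF : L2 nu F.
  apply: (@L2_bounded _ _ _ _ _ 1).
  - by rewrite lebesgue01T ltry.
  - by apply: cmeasurable_real; exact: measurable_indic.
  - move=> x; rewrite cmod_real indicE.
    by case: (_ \in _); rewrite ?expr1n ?expr0n.
apply: parseval_of_ae_cvg => //.
have ae1 : {ae nu, forall x : T, x != 0 :> R /\ x != 1 :> R}.
  by have := ae_nu_neq (0 : R); have := ae_nu_neq (1 : R); apply: filterS2.
have ae2 : {ae nu, forall x : T, 0 <= (x : R) <= 1 /\ x != a :> R}.
  apply: (@filterS2 T _ _ (fun x : T => 0 <= (x : R) <= 1)
    (fun x : T => x != a :> R)).
  - by [].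
  - exact: ae_nu01.
  - exact: ae_nu_neq.
move: ae1 ae2; apply: filterS2 => x [x0 x1] [/andP[x0' x1'] xa].
have {}x0 : 0 < x by rewrite lt_neqAle eq_sym x0.
have {}x1 : x < 1 by rewrite lt_neqAle x1.
have xa' : 0 < `|x - a| by rewrite normr_gt0 subr_eq0.
(* The distance to a keeps y away from x when the values differ; the distances to 0 and 1 keep |y -
   x| at most 1 - rho. *)
pose rho := Num.min (1/2) (Num.min `|x - a| (Num.min x (1 - x))).
have [r1 r2 r3 r4] : [/\ rho <= 1/2, rho <= `|x - a|, rho <= x & rho <= 1 - x].
  by rewrite /rho !ge_min !lexx !orbT.
apply: (@fsum_cvg_of_gap _ _ _ rho) => //.
  rewrite r1 !lt_min x0 subr_gt0 x1 xa' !andbT.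
  by lra.
move=> y /andP[y0 y1] Fyx.
have {Fyx} [[ay xa1]|[ya ax]] : (a < y /\ x <= a) \/ (y <= a /\ a < x).
  move: Fyx; rewrite /F !indicE !mem_setE !in_itv/= !andbT.
  have [ay|ya] := ltP a y; have [ax|xa1] := ltP a x; rewrite ?eqxx//.
    by left.
  by right.
- have E1 : `|x - a| = a - x by rewrite distrC ger0_norm ?subr_ge0.
  have E2 : `|y - x| = y - x by rewrite ger0_norm// subr_ge0 (le_trans xa1)// ltW.
  rewrite E1 in r2; rewrite E2; clearbody rho; clear -r2 r3 r4 ay xa1 y0 y1; lra.
- have E1 : `|x - a| = x - a by rewrite ger0_norm// subr_ge0 ltW.
  have E2 : `|y - x| = x - y.
    by rewrite distrC ger0_norm// subr_ge0 (le_trans ya)// ltW.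
  rewrite E1 in r2; rewrite E2; clearbody rho; clear -r2 r3 r4 ya ax y0 y1; lra.
Qed.

(** Dominated convergence turns pointwise into L2 convergence, and the Parseval class is closed. It
    serves both disjoint unions and simple approximations. *)
Lemma parseval_lim (u_ : nat -> T -> R) (u h : T -> R) :
  (forall n, parseval (fun x => (u_ n x)%:C)) ->
  measurable_fun setT u -> L2 nu (fun x => (h x)%:C) ->
  (forall x, u_ ^~ x @ \oo --> u x) -> (forall n x, `|u_ n x| <= `|h x|) ->
  parseval (fun x => (u x)%:C).
Proof.
move=> Pu mu Lh cu uh.
have uh' x : `|u x| <= `|h x|.
  have cu' : (fun n => `|u_ n x|) @ \oo --> `|u x| by apply: cvg_norm; exact: cu.
  rewrite -(cvg_lim _ cu')//; apply: limr_le.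
    by apply/cvg_ex; eexists; exact: cu'.
  exact: nearW.
have Lu : L2 nu (fun x => (u x)%:C).
  apply: (@L2_dominated _ _ _ _ _ (fun x => (h x)%:C) 1) => //.
  by apply/nearW => x; rewrite mul1r !cmod_real -[leLHS]real_normK ?num_real//
    -[leRHS]real_normK ?num_real// lerXn2r ?nnegrE.
have Ld n : L2 nu (fun x => (u x)%:C - (u_ n x)%:C).
  by apply: L2B => //; exact: (Pu n).1.
suff c0 : (fun n => normsq nu (fun x => (u x)%:C - (u_ n x)%:C)) @ \oo --> 0.
  apply: parseval_approx => // eps eps0.
  have /ge0_cvg0P := c0; move=> /(_ (fun=> normsq_ge0 _ _) _ eps0).
  move=> [N _ /(_ N (leqnn N))] HN.
  by exists (fun x => (u_ N x)%:C).
have mun n : measurable_fun setT (u_ n) by have [+ _] := L2_cmeasurable (Pu n).1.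
have [mh _] := L2_cmeasurable Lh.
have m_ n : measurable_fun setT (fun x => ((u x - u_ n x) ^+ 2)%:E).
  by apply/measurable_EFinP; apply: measurable_funX; exact: measurable_funB.
have c_ : {ae nu, forall x, setT x ->
    (fun n => ((u x - u_ n x) ^+ 2)%:E) @ \oo --> (cst 0%E x)}.
  apply/nearW => x _; apply: cvg_EFin_seq.
  rewrite -[X in _ --> X](mulr0 0) -[in X in _ --> X](subrr (u x)).
  by under eq_fun do rewrite expr2; apply: cvgM; apply: cvgB => //; exact: cvg_cst.
(* The constant 4 comes from |u - u_n| <= 2|h|. *)
have i_ : nu.-integrable setT (fun x => (4 * h x ^+ 2)%:E).
  under eq_fun do rewrite EFinM; apply: integrableZl => //.
  by apply: Lfun2_integrable_sqr; exact: Lh.1.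
have d_ : {ae nu, forall x n, setT x ->
    (`|((u x - u_ n x) ^+ 2)%:E| <= (4 * h x ^+ 2)%:E)%E}.
  apply/nearW => x n _; rewrite /= lee_fin normrX.
  apply: (@le_trans _ _ ((2 * `|h x|) ^+ 2)).
    rewrite lerXn2r ?nnegrE ?mulr_ge0// (le_trans (ler_normB _ _))//.
    by rewrite mulr_natl mulr2n lerD.
  by rewrite exprMn real_normK ?num_real// -natrX.
have [_ _] := dominated_convergence measurableT m_ (measurable_cst _) c_ i_ d_.
rewrite integral_cst// mul0e => /fine_cvgP[_]; apply: cvg_trans.
apply: near_eq_cvg; apply: nearW => n /=.
by congr fine; apply: eq_integral => x _; rewrite -rmorphB/= cmod_real.
Qed.

(** The half-lines generate the Borel sets and are stable under intersection; complements follow by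
    linearity, disjoint unions by [parseval_lim] with the bound 1. *)
Lemma parseval_indic (A : set T) : measurable A -> parseval (fun x => (\1_A x)%:C).
Proof.
move=> mA.
pose P (A : set T) := parseval (fun x => (\1_A x)%:C).
have PT : P setT.
  rewrite /P (_ : (fun x => _) = fun=> (1 : R)%:C); first exact: parseval_cst.
  by apply/funext => x; rewrite indicT.
rewrite -[parseval _]/(P A).
apply: (@dynkin_induction _ T (@RGenOInfty.G R) P).
- exact: RGenOInfty.measurableE.
- move=> _ _ [x ->] [y ->]; exists (Num.max x y).
  by apply/seteqP; split => z /=; rewrite !in_itv/= !andbT gt_max => /andP.
- exact: PT.
- move=> _ [x ->]; exact: parseval_itv.
- move=> S mS PS; rewrite /P.
  rewrite (_ : (fun x => _) = fun x => (\1_setT x)%:C + (-1) * (\1_S x)%:C).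
    exact: parsevalD PT (parsevalZ _ PS).
  apply/funext => x; rewrite !indicE in_setC in_setT.
  by case: (x \in S); rewrite /= ?mulr1 ?subrr ?mulr0 ?addr0.
- move=> F mF tF PF; rewrite /P.
  (* By disjointness at most one of the sets contains x, so the partial sums at x are constantly 0
     or jump once from 0 to 1; convergence and the bound 1 are both read off from this. *)
  have sumI (x : T) : ((forall n, \sum_(k < n) \1_(F k) x = 0 :> R) /\
        \1_(\bigcup_k F k) x = 0 :> R) \/
      exists i, (forall n, \sum_(k < n) \1_(F k) x = (i < n)%:R :> R) /\
        \1_(\bigcup_k F k) x = 1 :> R.
    have [[i _ Fix]|xF] := pselect ((\bigcup_k F k) x); [right; exists i|left].
      split; last by rewrite indicE mem_set//; exists i.
      have Fk k : k != i -> \1_(F k) x = 0 :> R.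
        move=> ki; rewrite indicE memNset// => Fkx.
        by have /eqP := tF k i I I (ex_intro _ x (conj Fkx Fix)); rewrite (negbTE ki).
      move=> n; have [ni|ni] := ltnP i n.
        rewrite (bigD1 (Ordinal ni))//= big1 ?addr0; first by rewrite indicE mem_set.
        by move=> k ki; apply: Fk.
      by rewrite big1// => k _; apply: Fk; rewrite ltn_eqF// (leq_trans (ltn_ord k)).
    split; last by rewrite indicE memNset.
    move=> n; rewrite big1// => k _; rewrite indicE memNset// => Fkx.
    by apply: xF; exists k.
  apply: (@parseval_lim (fun n x => \sum_(k < n) \1_(F k) x) _ (cst 1)).
  + move=> n; under eq_fun do rewrite rmorph_sum/=.
    by apply: parseval_sum => k; exact: PF.
  + by apply: measurable_indic; exact: bigcup_measurable.
  + have [+ _] := PT; congr L2; apply/funext => x; by rewrite indicT.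
  + move=> x; have [[E0 ->]|[k [Ek ->]]] := sumI x.
      by under eq_fun do rewrite E0; exact: cvg_cst.
    apply: (@cvg_trans _ (cst (1 : R) @ \oo)); last exact: cvg_cst.
    apply: near_eq_cvg; exists k.+1 => // n /= kn.
    by rewrite Ek kn.
  + move=> n x; rewrite normr1; have [[-> _]|[k [-> _]]] := sumI x.
      by rewrite normr0.
    by case: (k < n)%N; rewrite ?normr1 ?normr0.
- by move: mA; rewrite (RGenOInfty.measurableE R : @measurable _ T = <<s _ >>).
Qed.

Lemma parseval_nnsfun (f : {nnsfun T >-> R}) : parseval (fun x => (f x)%:C).
Proof.
under eq_fun => x do rewrite fimfunEord rmorph_sum.
apply: parseval_sum => i.
under eq_fun do rewrite rmorphM.
by apply: parsevalZ; exact: parseval_indic.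
Qed.

(** The simple approximations lie below [u], which is therefore its own dominating function. *)
Lemma parseval_ge0 (u : T -> R) : (forall x, 0 <= u x) ->
  L2 nu (fun x => (u x)%:C) -> parseval (fun x => (u x)%:C).
Proof.
move=> u0 Lu; have [mu1 _] := L2_cmeasurable Lu.
have mu : measurable_fun setT (EFin \o u) by exact/measurable_EFinP.
pose g := nnsfun_approx measurableT mu.
apply: (@parseval_lim g u u) => //.
- by move=> n; exact: parseval_nnsfun.
- move=> x; have := @cvg_nnsfun_approx _ T R setT measurableT _ mu
    (fun y _ => u0 y) x I => /fine_cvgP[_].
  exact.
- move=> n x; rewrite !ger0_norm//.
  rewrite -lee_fin /g nnsfun_approxE; apply: le_approx => //.
  by move=> y _; rewrite lee_fin.
Qed.

Lemma parseval_L2 f : L2 nu f -> parseval f.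
Proof.
move=> Lf; have [m1 m2] := L2_cmeasurable Lf.
have Pr (u : T -> R) : measurable_fun setT u ->
    (forall x, u x ^+ 2 <= cmod (f x) ^+ 2) -> parseval (fun x => (u x)%:C).
  move=> mu uf.
  have D (v : T -> R) : measurable_fun setT v -> (forall x, 0 <= v x) ->
      (forall x, v x <= `|u x|) -> parseval (fun x => (v x)%:C).
    move=> mv v0 vu; apply: parseval_ge0 => //.
    apply: (@L2_dominated _ _ _ _ _ f 1) => //.
    apply/nearW => x; rewrite cmod_real mul1r (le_trans _ (uf x))//.
    by rewrite -[leRHS]real_normK ?num_real// lerXn2r ?nnegrE.
  rewrite (_ : (fun x => _) = fun x =>
      (Num.max (u x) 0)%:C + (-1) * (Num.max (- u x) 0)%:C).
    apply: parsevalD; last apply: parsevalZ; apply: D.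
    - exact: measurable_maxr.
    - by move=> x; rewrite le_max lexx orbT.
    - by move=> x; rewrite ge_max normr_ge0 ler_norm.
    - by apply: measurable_maxr => //; exact: measurable_funN.
    - by move=> x; rewrite le_max lexx orbT.
    - by move=> x; rewrite ge_max normr_ge0 -normrN ler_norm.
  apply/funext => x; rewrite mulN1r -rmorphB/=; congr _%:C.
  by case: (leP (u x) 0); case: (leP (- u x) 0); lra.
rewrite (_ : f = fun x => (complex.Re (f x))%:C + 'i%C * (complex.Im (f x))%:C).
  apply: parsevalD; last apply: parsevalZ; apply: Pr => // x; rewrite cmod_sq.
  - by rewrite lerDl sqr_ge0.
  - by rewrite lerDr sqr_ge0.
by apply/funext => x; exact: complexE.
Qed.

End Completeness.

(** * The dual frame *)

Section EsumEnergy.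
Context {R : realType}.
Local Notation nu :=
  (lebesgue01 R : {measure set (measurableTypeR R) -> \bar R}).
Local Notation T := (measurableTypeR R).

(** Bessel bounds the sum over every finite set of integers; conversely the ranges -M..M are such
    sets, and by Parseval their sums tend to the squared norm. *)
Lemma esum_fcoef (f : T -> R[i]) : L2 nu f ->
  (\esum_(j in [set: int]) (cmod (fcoef f j) ^+ 2)%:E = (normsq nu f)%:E)%E.
Proof.
move=> Lf; apply/eqP; rewrite eq_le; apply/andP; split.
  apply: ge_ereal_sup => _ [A [fA _] <-].
  rewrite fsbig_finite//= sumEFin lee_fin.
  by apply: bessel => //;
    [exact: L2_expfun|exact: expfun_orthonormal|exact: finmap.fset_uniq].
have [_ /cvg_EFin_seq h] := parseval_L2 Lf.
rewrite -(cvg_lim _ h)//; apply: lime_le; first by apply/cvg_ex; eexists; exact: h.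
apply: nearW => M; rewrite /energy -sumEFin.
rewrite (fsbig_seq _ _ (symidx_uniq M)).
apply: ereal_sup_ubound; exists [set` symidx M] => //; split => //.
exact: finite_seq.
Qed.

End EsumEnergy.

Lemma cvg_sum0 (R : realType) (I : Type) (s : seq I) (F : I -> nat -> R) :
  (forall i, F i @ \oo --> 0) -> (fun n => \sum_(i <- s) F i n) @ \oo --> 0.
Proof.
move=> F0; elim: s => [|i s IH].
  by under eq_fun do rewrite big_nil; exact: cvg_cst.
rewrite (_ : (fun k => _) = F i \+ (fun k => \sum_(j <- s) F j k)); last first.
  by apply/funext => k; rewrite big_cons.
by rewrite -[X in _ --> X]addr0; apply: cvgD.
Qed.

Lemma pos_lower_bound (R : realType) (I : finType) (F : I -> R) :
  (forall i, 0 < F i) -> exists2 r : R, 0 < r & forall i, r <= F i.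
Proof.
(* Starting from 1 keeps the minimum positive for empty [I], for instance when there are no
   atoms. *)
move=> F0; exists (\big[Num.min/1]_i F i).
  by elim/big_ind: _ => // x y x0 y0; rewrite lt_min x0.
by move=> i; rewrite (bigD1 i)//= ge_min lexx.
Qed.

Section Core.
Context {R : realType}.
Local Notation nu :=
  (lebesgue01 R : {measure set (measurableTypeR R) -> \bar R}).
Local Notation e := (@expfun R).
Local Notation T := (measurableTypeR R).
Variables (n : nat) (a b : 'I_n -> R) (c m M : R) (w : T -> R).
Variable mu : {measure set T -> \bar R}.
Hypotheses (a0 : forall k, 0 < a k) (bc : forall k, 0 < b k < c) (c1 : c <= 1)
  (b_inj : injective b) (m0 : 0 < m) (mw : measurable_fun setT w)
  (w_supp : forall x, x \notin `[c, 1[ -> w x = 0)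
  (w_bnd : forall x, x \in `[c, 1[ -> m <= w x <= M).
(** The only fact about [mu] on which this section relies: the finiteness of [mu] and the formula
    for complex integrals are derived from it. *)
Hypothesis mu_integral : forall h : T -> \bar R, measurable_fun setT h ->
  (forall x, (0 <= h x)%E) ->
  (\int[mu]_x h x = \sum_(k < n) (a k)%:E * h (b k) + \int[nu]_x (h x * (w x)%:E))%E.

Let w_ge0 x : 0 <= w x.
Proof.
have [/w_bnd/andP[mwx _]|/w_supp->//] := boolP (x \in `[c, 1[).
by rewrite (le_trans _ mwx)// ltW.
Qed.

Let w_leM x : w x <= Num.max M 0.
Proof.
have [/w_bnd/andP[_ mwx]|/w_supp->//] := boolP (x \in `[c, 1[).
  by rewrite le_max mwx.
by rewrite le_max lexx orbT.
Qed.

Let mu_lty : (mu setT < +oo)%E.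
Proof.
have := mu_integral (measurable_cst 1%E) (fun=> lee01).
rewrite integral_cst// mul1e => ->; apply: lte_add_pinfty.
  under eq_bigr do rewrite /= mule1.
  by rewrite sumEFin ltry.
apply: (@le_lt_trans _ _ (\int[nu]_x (Num.max M 0)%:E)%E).
  apply: ge0_le_integral => //=.
  - by move=> x _; rewrite mul1e lee_fin.
  - by under eq_fun do rewrite mul1e; exact/measurable_EFinP.
  - by move=> x _; rewrite mul1e lee_fin.
by rewrite integral_cst// lebesgue01T mule1 ltry.
Qed.

Let sqint_mu f : cmeasurable f ->
  (sqint mu f = (\sum_(k < n) a k * cmod (f (b k)) ^+ 2)%:E +
    \int[nu]_x (cmod (f x) ^+ 2 * w x)%:E)%E.
Proof.
move=> mf; rewrite /sqint mu_integral.
- by congr (_ + _)%E; rewrite -sumEFin.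
- by apply/measurable_EFinP; exact: measurable_cmod_sq.
- by move=> x; rewrite lee_fin sqr_ge0.
Qed.

Let Rintegral_mu_ge0 (h : T -> R) : (forall x, 0 <= h x) ->
  mu.-integrable setT (EFin \o h) ->
  nu.-integrable setT (fun x => (h x * w x)%:E) /\
  \int[mu]_x h x = \sum_(k < n) a k * h (b k) + \int[nu]_x (h x * w x).
Proof.
move=> h0 ih; have mh : measurable_fun setT h.
  by apply/measurable_EFinP; exact: measurable_int ih.
have E := mu_integral (measurable_int _ ih) (fun x => h0 x : (0%E <= (h x)%:E)%E).
have sE : (\sum_(k < n) (a k)%:E * (h (b k))%:E = (\sum_(k < n) a k * h (b k))%:E)%E.
  by rewrite -sumEFin.
have mhw : measurable_fun setT (fun x => (h x * w x)%:E).
  by apply/measurable_EFinP; exact: measurable_funM.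
have w0 x : (0 <= (h x * w x)%:E)%E by rewrite lee_fin mulr_ge0.
have fin : (\int[nu]_x (h x * w x)%:E < +oo)%E.
  have := integrable_lty measurableT ih; rewrite /comp E sE; apply: le_lt_trans.
  by rewrite leeDr// lee_fin sumr_ge0// => k _; rewrite mulr_ge0// ltW.
have finN : (\int[nu]_x (h x * w x)%:E)%E \is a fin_num.
  by rewrite ge0_fin_numE// integral_ge0.
split.
  apply/integrableP; split => //.
  by under eq_integral do rewrite gee0_abs//.
by rewrite {1}/Rintegral [X in fine X]E sE -[X in (_ + X)%E](fineK finN).
Qed.

Let Rintegral_mu (h : T -> R) :
  mu.-integrable setT (EFin \o h) ->
  nu.-integrable setT (fun x => (h x * w x)%:E) /\
  \int[mu]_x h x = \sum_(k < n) a k * h (b k) + \int[nu]_x (h x * w x).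
Proof.
move=> ih; have ia : mu.-integrable setT (EFin \o (fun x => `|h x|)).
  exact: integrable_norm ih.
have ip : mu.-integrable setT (EFin \o (fun x => h x + `|h x|)).
  exact: (@integrableD _ _ _ mu setT measurableT (EFin \o h)
    (EFin \o (fun x => `|h x|))).
(* Both h + |h| and |h| are nonnegative and integrable, so the nonnegative case applies to each. *)
have hE x : h x = (h x + `|h x|) - `|h x| by rewrite addrK.
have [|j1 E1] := Rintegral_mu_ge0 _ ip.
  by move=> x; rewrite -lerBlDr sub0r lerNl ler_normr lexx orbT.
have [|j2 E2] := Rintegral_mu_ge0 _ ia; first by move=> x.
split.
  rewrite (_ : (fun x => _) = fun x =>
      (((h x + `|h x|) * w x)%:E - (`|h x| * w x)%:E)%E).
    exact: integrableB.
  by apply/funext => x; rewrite -EFinB -mulrBl addrK.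
under eq_Rintegral do rewrite hE.
rewrite RintegralB// E1 E2.
under [in RHS]eq_Rintegral do rewrite hE mulrBl.
rewrite RintegralB// opprD addrACA -sumrB; congr (_ + _).
by apply: eq_bigr => k _; rewrite -mulrBr addrK.
Qed.

Let cint_mu f : cintegrable mu f -> 
  cint mu f = \sum_(k < n) (a k)%:C * f (b k) + cint nu (fun x => f x * (w x)%:C).
Proof.
move=> [/Rintegral_mu[_ E1] /Rintegral_mu[_ E2]].
have reE (z : R[i]) (x : R) : complex.Re (x%:C * z) = x * complex.Re z.
  by rewrite reM /= mul0r subr0.
have imE (z : R[i]) (x : R) : complex.Im (x%:C * z) = x * complex.Im z.
  by rewrite imM /= mul0r addr0.
apply: eq_ReIm; rewrite ?reD ?imD raddf_sum/=.
- rewrite E1; congr (_ + _); first by apply: eq_bigr => k _; rewrite reE.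
  by apply: eq_Rintegral => x _; rewrite reM /= mulr0 subr0.
- rewrite E2; congr (_ + _); first by apply: eq_bigr => k _; rewrite imE.
  by apply: eq_Rintegral => x _; rewrite imM /= mulr0 add0r.
Qed.


(** * Spreading the atoms over disjoint intervals *)

Variable r : R.
(** [rb] and [rc] keep the intervals of radius r inside [0,c] and [rsep] makes them disjoint. With c
    <= 1 they also give |y - b_k| <= 1 - r on [0,1], the circle part of the gap condition at b_k. *)
Hypotheses (r0 : 0 < r) (r2 : r <= 1 / 2) (rb : forall k, r <= b k)
  (rc : forall k, b k + r <= c)
  (rsep : forall k l, k != l -> 2 * r <= `|b k - b l|).

Definition atom_itv (k : 'I_n) : set T := `]b k - r, b k + r[%classic.
Definition tail_itv : set T := `[c, 1[%classic.

Definition extend (f : T -> R[i]) (x : T) : R[i] :=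
  (\1_tail_itv x)%:C * f x + \sum_(k < n) f (b k) * (\1_(atom_itv k) x)%:C.

(** The value at b_k of the adjoint of [extend] applied to [e j]; the factor 1/a_k cancels the mass
    of the atom. *)
Definition dual_atom (j : int) (k : 'I_n) : R[i] :=
  (a k)^-1%:C * (L2dot nu (fun x => (\1_(atom_itv k) x)%:C) (e j))^*.

(** An explicit representative of the adjoint of [extend] at [e j]. On [c,1) the division by [w]
    compensates for the density of [mu]; elsewhere the numerator is 0, so the quotient is 0 although
    [w] vanishes too. *)
Definition dual_seq (j : int) (x : T) : R[i] :=
  (\1_tail_itv x / w x)%:C * e j x + \sum_(k < n) (x == b k)%:R%:C * dual_atom j k.

Lemma tail_in x : x \in `[c, 1[ -> \1_tail_itv x = 1 :> R.
Proof. by move=> xc; rewrite indicE mem_set. Qed.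

Lemma tail_out x : x \notin `[c, 1[ -> \1_tail_itv x = 0 :> R.
Proof. by move=> xc; rewrite indicE memNset//=; exact/negP. Qed.

Lemma atom_in k x : `|x - b k| < r -> \1_(atom_itv k) x = 1 :> R.
Proof.
by rewrite ltr_distl => xr; rewrite indicE mem_set// /atom_itv/= in_itv.
Qed.

Lemma atom_out k x : ~~ (`|x - b k| < r) -> \1_(atom_itv k) x = 0 :> R.
Proof.
rewrite ltr_distl => xr; rewrite indicE memNset// /atom_itv/= in_itv/=.
exact/negP.
Qed.

Lemma atom_notin_tail k x : `|x - b k| < r -> x \notin `[c, 1[.
Proof.
rewrite ltr_distl => /andP[_ xr]; rewrite in_itv/= negb_and -ltNge.
by rewrite (lt_le_trans xr (rc k)).
Qed.

Lemma atom_disj k l x : `|x - b k| < r -> l != k -> ~~ (`|x - b l| < r).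
Proof.
move=> xk lk; apply/negP => xl; have := rsep lk; apply/negP; rewrite -ltNge.
have -> : b l - b k = (x - b k) - (x - b l) by ring.
by rewrite (le_lt_trans (ler_normB _ _))// mulr_natl mulr2n ltrD.
Qed.

Lemma extend_tail f x : x \in `[c, 1[ -> extend f x = f x.
Proof.
move=> xc; rewrite /extend tail_in// mul1r big1 ?addr0// => k _.
by rewrite atom_out ?mulr0//; apply/negP => /atom_notin_tail; rewrite xc.
Qed.

Lemma extend_atom f k x : `|x - b k| < r -> extend f x = f (b k).
Proof.
move=> xk; rewrite /extend tail_out; last exact: atom_notin_tail xk.
rewrite mul0r add0r (bigD1 k)//= atom_in// mulr1 big1 ?addr0// => l lk.
by rewrite atom_out ?mulr0//; exact: atom_disj xk lk.
Qed.

(** At each point at most one summand of [extend] is nonzero, so no cross terms appear. *)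
Lemma cmod_extend f x : cmod (extend f x) ^+ 2 =
  \1_tail_itv x * cmod (f x) ^+ 2 +
  \sum_(k < n) cmod (f (b k)) ^+ 2 * \1_(atom_itv k) x.
Proof.
have [xc|xc] := boolP (x \in `[c, 1[).
  rewrite extend_tail// tail_in// mul1r big1 ?addr0// => k _.
  by rewrite atom_out ?mulr0//; apply/negP => /atom_notin_tail; rewrite xc.
rewrite tail_out// mul0r add0r.
have [[k xk]|xk] := pselect (exists k, `|x - b k| < r).
  rewrite (extend_atom _ xk) (bigD1 k)//= atom_in// mulr1 big1 ?addr0// => l lk.
  by rewrite atom_out ?mulr0//; exact: atom_disj xk lk.
have xk' k : ~~ (`|x - b k| < r) by apply/negP => xk'; apply: xk; exists k.
rewrite /extend tail_out// mul0r add0r !big1 ?cmod0 ?expr0n// => k _.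
  by rewrite atom_out ?mulr0//.
by rewrite atom_out ?mulr0//.
Qed.

Lemma measurable_tail : measurable_fun setT (\1_tail_itv : T -> R).
Proof. by apply: measurable_indic; exact: measurable_itv. Qed.

Lemma measurable_atom k : measurable_fun setT (\1_(atom_itv k) : T -> R).
Proof. by apply: measurable_indic; exact: measurable_itv. Qed.

Lemma cmeasurable_extend f : cmeasurable f -> cmeasurable (extend f).
Proof.
move=> mf; apply: cmeasurableD.
  by apply: cmeasurableM => //; apply: cmeasurable_real; exact: measurable_tail.
apply: cmeasurable_sum => k; apply: cmeasurableM; first exact: cmeasurable_cst.
by apply: cmeasurable_real; exact: measurable_atom.
Qed.

Lemma lebesgue01_atom k : (\int[nu]_x (\1_(atom_itv k) x)%:E = (2 * r)%:E)%E.
Proof.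
rewrite integral_nu; last 2 first.
- by apply/measurable_EFinP; exact: measurable_atom.
- by move=> x; rewrite lee_fin.
rewrite integral_indic; [|by []|exact: measurable_itv].
(* [nu] sees only [0,1]; the interval lies inside, so its full length counts. *)
rewrite (_ : atom_itv k `&` _ = atom_itv k); last first.
  apply: setIidl => x; rewrite /atom_itv/= !in_itv/= => /andP[x1 x2].
  have := rb k; have := rc k; move: x1 x2 c1; move: (b k) => bk ? ? ? ? ?.
  by apply/andP; split; lra.
have := lebesgue_measure_itv `]b k - r, b k + r[ => /= ->.
rewrite lte_fin ifT; last by move: r0; lra.
by rewrite -EFinB; congr EFin; ring.
Qed.

Lemma sqint_extend f : cmeasurable f -> sqint nu (extend f) =
  (\int[nu]_x (\1_tail_itv x * cmod (f x) ^+ 2)%:E +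
   (2 * r * \sum_(k < n) cmod (f (b k)) ^+ 2)%:E)%E.
Proof.
move=> mf; rewrite /sqint; under eq_integral do rewrite cmod_extend EFinD.
rewrite ge0_integralD//=; last 4 first.
- by move=> x _; rewrite lee_fin mulr_ge0// sqr_ge0.
- apply/measurable_EFinP; apply: measurable_funM; first exact: measurable_tail.
  exact: measurable_cmod_sq.
- by move=> x _; rewrite lee_fin sumr_ge0// => k _; rewrite mulr_ge0// sqr_ge0.
- apply/measurable_EFinP; apply: measurable_sum => k.
  by apply: measurable_funM => //; exact: measurable_atom.
congr (_ + _)%E; under eq_integral do rewrite -sumEFin.
rewrite ge0_integral_sum//=; last 2 first.
- move=> k; apply/measurable_EFinP; apply: measurable_funM => //.
  exact: measurable_atom.
- by move=> k x _; rewrite lee_fin mulr_ge0// sqr_ge0.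
rewrite mulr_sumr -sumEFin; apply: eq_bigr => k _.
under eq_integral do rewrite EFinM.
rewrite ge0_integralZl//; last 2 first.
- by apply/measurable_EFinP; exact: measurable_atom.
- by rewrite lee_fin sqr_ge0.
by rewrite [X in (_ * X)%E]lebesgue01_atom -EFinM mulrC.
Qed.


(** If c = 1, then [w_bnd] is void and says nothing about the sign of [M]; the maximum gives a
    nonnegative bound in every case. *)
Let Mx := Num.max M 0.

Lemma weighted_bounds f : cmeasurable f ->
  (m%:E * \int[nu]_x (\1_tail_itv x * cmod (f x) ^+ 2)%:E <=
    \int[nu]_x (cmod (f x) ^+ 2 * w x)%:E <=
   Mx%:E * \int[nu]_x (\1_tail_itv x * cmod (f x) ^+ 2)%:E)%E.
Proof.
move=> mf.
have mt : measurable_fun setT (fun x => \1_tail_itv x * cmod (f x) ^+ 2 : R).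
  by apply: measurable_funM; [exact: measurable_tail|exact: measurable_cmod_sq].
have mfw : measurable_fun setT (fun x => cmod (f x) ^+ 2 * w x).
  by apply: measurable_funM => //; exact: measurable_cmod_sq.
have t0 x : 0 <= \1_tail_itv x * cmod (f x) ^+ 2 by rewrite mulr_ge0// sqr_ge0.
have M0 : 0 <= Mx by rewrite /Mx le_max lexx orbT.
have Z (k : R) : 0 <= k ->
    (k%:E * \int[nu]_x (\1_tail_itv x * cmod (f x) ^+ 2)%:E =
     \int[nu]_x (k * (\1_tail_itv x * cmod (f x) ^+ 2))%:E)%E.
  move=> k0; under [RHS]eq_integral do rewrite EFinM.
  rewrite ge0_integralZl//; first exact/measurable_EFinP.
  by move=> x _; rewrite lee_fin.
rewrite (Z _ (ltW m0)) (Z _ M0).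
apply/andP; split; apply: ge0_le_integral => //.
- by move=> x _; rewrite lee_fin mulr_ge0// ltW.
- by apply/measurable_EFinP; exact: measurable_funM.
- exact/measurable_EFinP.
- move=> x _; rewrite lee_fin.
  have [xc|xc] := boolP (x \in `[c, 1[).
    rewrite tail_in// mul1r mulrC ler_wpM2l ?sqr_ge0//.
    by have /andP[] := w_bnd xc.
  by rewrite tail_out// mul0r mulr0 mulr_ge0 ?sqr_ge0.
- by move=> x _; rewrite lee_fin mulr_ge0 ?sqr_ge0.
- exact/measurable_EFinP.
- by apply/measurable_EFinP; exact: measurable_funM.
- move=> x _; rewrite lee_fin.
  have [xc|xc] := boolP (x \in `[c, 1[).
    by rewrite tail_in// mul1r mulrC ler_wpM2r ?sqr_ge0.
  by rewrite tail_out// mul0r mulr0 w_supp// mulr0.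
Qed.

(** Reduces the frame inequalities to real arithmetic: z and y are the integrals of |f|^2 over [c,1)
    without and with the density. *)
Lemma extend_normsq f : L2 mu f -> exists z y : R,
  [/\ 0 <= z, m * z <= y & y <= Mx * z] /\
  [/\ (\int[nu]_x (\1_tail_itv x * cmod (f x) ^+ 2)%:E = z%:E)%E,
      normsq mu f = \sum_(k < n) a k * cmod (f (b k)) ^+ 2 + y &
      sqint nu (extend f) = (z + 2 * r * \sum_(k < n) cmod (f (b k)) ^+ 2)%:E].
Proof.
move=> Lf; have mf := L2_cmeasurable Lf.
have := weighted_bounds mf; have := sqint_extend mf; have := sqint_mu mf.
rewrite (sqintE Lf).
have : (0 <= \int[nu]_x (\1_tail_itv x * cmod (f x) ^+ 2)%:E)%E.
  by apply: integral_ge0 => x _; rewrite lee_fin mulr_ge0// sqr_ge0.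
case: (integral nu setT (fun x => (\1_tail_itv x * cmod (f x) ^+ 2)%:E)) => [z|_|//];
  last first.
  (* Were the unweighted integral infinite, m > 0 would make the weighted one infinite too, against
     f in L2 of [mu]. *)
  move=> E _ /andP[+ _]; rewrite gt0_muley ?lte_fin// leye_eq => /eqP EE.
  by move: E; rewrite EE.
case: (integral nu setT (fun x => (cmod (f x) ^+ 2 * w x)%:E)) => [y|//|//].
rewrite !lee_fin => z0 [E1] E2 /andP[y1 y2].
by exists z, y; do 2! split.
Qed.

Lemma L2_extend f : L2 mu f -> L2 nu (extend f).
Proof.
move=> Lf; have [z [y [_ [_ _ E]]]] := extend_normsq Lf.
apply/L2P; split; last by rewrite E ltry.
by apply: cmeasurable_extend; exact: L2_cmeasurable Lf.
Qed.

Lemma L2_tail f : L2 mu f -> L2 nu (fun x => (\1_tail_itv x)%:C * f x).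
Proof.
move=> Lf; have [z [y [_ [E _ _]]]] := extend_normsq Lf.
apply/L2P; split.
  apply: cmeasurableM; last exact: L2_cmeasurable Lf.
  by apply: cmeasurable_real; exact: measurable_tail.
rewrite (_ : sqint _ _ = z%:E) ?ltry// -E; apply: eq_integral => x _.
rewrite cmod_sqM cmod_real expr2 indicE.
by case: (_ \in _); rewrite /= ?mulr1 ?mulr0.
Qed.

Lemma L2_atom k : L2 nu (fun x => (\1_(atom_itv k) x)%:C).
Proof.
apply: (@L2_bounded _ _ _ _ _ 1).
- by rewrite lebesgue01T ltry.
- by apply: cmeasurable_real; exact: measurable_atom.
- by move=> x; rewrite cmod_real indicE; case: (_ \in _); rewrite ?expr1n ?expr0n.
Qed.

Lemma L2_dual_seq j : L2 mu (dual_seq j).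
Proof.
apply: L2D.
  have wE x : \1_tail_itv x / w x = \1_tail_itv x * (w x) `^ (- 1) :> R.
    by rewrite powR_inv1.
  apply: (@L2_bounded _ _ _ _ _ (m^-1 ^+ 2)) => //.
    apply: cmeasurableM; last exact: cmeasurable_expfun.
    apply: cmeasurable_real; under eq_fun do rewrite wE.
    apply: measurable_funM; first exact: measurable_tail.
    exact: (@measurableT_comp _ _ _ _ _ _ (fun z : R => z `^ (- 1))).
  move=> x; rewrite cmod_sqM cmod_expfun mulr1 cmod_real.
  have [xc|xc] := boolP (x \in `[c, 1[); last first.
    by rewrite tail_out// mul0r expr0n sqr_ge0.
  rewrite tail_in// mul1r lerXn2r ?nnegrE ?invr_ge0// ?(ltW m0)//.
  by have /andP[mwx _] := w_bnd xc; rewrite lef_pV2 ?posrE// (lt_le_trans m0).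
apply: L2_sum => k; apply: (@L2_bounded _ _ _ _ _ (cmod (dual_atom j k) ^+ 2)) => //.
  apply: cmeasurableM; last exact: cmeasurable_cst.
  apply: cmeasurable_real.
  rewrite (_ : (fun x => _) = \1_[set b k]); first exact: measurable_indic.
  apply/funext => x; rewrite indicE; congr (nat_of_bool _)%:R.
  by apply/idP/idP; rewrite inE => /eqP.
move=> x; rewrite cmod_sqM cmod_real.
by case: (x == b k); rewrite /= ?expr1n ?mul1r// expr0n mul0r sqr_ge0.
Qed.

Lemma atom_lt k x : x \in `[c, 1[ -> (x == b k) = false.
Proof.
rewrite in_itv/= => /andP[cx _]; apply/negbTE.
by rewrite gt_eqF// (lt_le_trans _ cx)//; have /andP[] := bc k.
Qed.

Lemma dual_seq_atom j k : dual_seq j (b k) = dual_atom j k.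
Proof.
rewrite /dual_seq tail_out; last by apply/negP => /(atom_lt k); rewrite eqxx.
rewrite mul0r mul0r add0r (bigD1 k)//= eqxx mul1r big1 ?addr0// => l lk.
by rewrite (inj_eq b_inj) eq_sym (negbTE lk) mul0r.
Qed.

Lemma dual_seq_tail f j x :
  f x * (dual_seq j x)^* * (w x)%:C = (\1_tail_itv x)%:C * f x * (e j x)^*.
Proof.
have [xc|xc] := boolP (x \in `[c, 1[); last first.
  by rewrite w_supp// tail_out// mulr0 !mul0r.
rewrite /dual_seq tail_in// big1; last first.
  by move=> k _; rewrite atom_lt// mul0r.
have wx0 : w x != 0.
  by have /andP[mwx _] := w_bnd xc; rewrite gt_eqF// (lt_le_trans m0).
have -> : ((1 / w x)%:C * e j x + 0)^* = (w x)^-1%:C * (e j x)^*.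
  rewrite addr0 div1r; apply: eq_ReIm; rewrite !(reM, imM, reJ, imJ)/=; ring.
have ww : (w x)^-1%:C * (w x)%:C = 1 by rewrite -rmorphM/= mulVf.
transitivity (f x * (e j x)^* * ((w x)^-1%:C * (w x)%:C)); first by ring.
by rewrite ww mulr1 mul1r.
Qed.

(** The atoms of [mu] yield the terms on the intervals, the density yields the term on [c,1). Beyond
    membership in L2, the frame and reconstruction proofs use [dual_seq] only through this
    identity. *)
Lemma L2dot_dual_seq f j : L2 mu f -> L2dot mu f (dual_seq j) = fcoef (extend f) j.
Proof.
move=> Lf; have Ld := L2_dual_seq j.
rewrite -[LHS]/(cint mu (fun x => f x * (dual_seq j x)^*)).
rewrite cint_mu; last exact: cintegrableM.
under eq_cint do rewrite dual_seq_tail.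
rewrite /fcoef /extend L2dotD; [|exact: L2_tail| |exact: L2_expfun]; last first.
  by apply: L2_sum => k; apply: L2Z; exact: L2_atom.
rewrite L2dot_sum; [|by move=> k; apply: L2Z; exact: L2_atom|exact: L2_expfun].
rewrite addrC; congr (_ + _); apply: eq_bigr => k _.
rewrite L2dotZ; [|exact: L2_atom|exact: L2_expfun].
have J (z : R) (y : R[i]) : (z%:C * y^*)^* = z%:C * y.
  by apply: eq_ReIm; rewrite !(reM, imM, reJ, imJ)/=; ring.
rewrite dual_seq_atom /dual_atom J mulrCA; congr (_ * _).
by rewrite mulrA -rmorphM mulfV ?rmorph1 ?mul1r// gt_eqF.
Qed.

(** * Frame bounds and reconstruction *)

Lemma dual_seq_frame : is_frame mu dual_seq.
Proof.
split; first exact: L2_dual_seq.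
have [al al0 alP] := pos_lower_bound a0.
(* An upper bound for every a_k and for [Mx]; the summand 1 keeps it positive when there are no
   atoms and [Mx] is 0. *)
pose be := \sum_(k < n) a k + (Mx + 1).
have M0 : 0 <= Mx by rewrite /Mx le_max lexx orbT.
have be0 : 0 < be by rewrite ltr_wpDl ?sumr_ge0// => [k _|]; [exact: ltW|lra].
pose al' := Num.min al m.
have al'0 : 0 < al' by rewrite lt_min al0.
(* Let X be the sum of the |f(b_k)|^2 and z the integral of |f|^2 over [c,1). The squared norm of f
   lies between al'(X + z) and be(X + z), that of [extend f] between 2r(X + z) and X + z, as 2r <=
   1; the bounds are the quotients. *)
exists (2 * r / be), al'^-1; rewrite divr_gt0 ?mulr_gt0// invr_gt0 al'0.
split=> //; split=> // f Lf.
under eq_esum do rewrite L2dot_dual_seq//.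
rewrite esum_fcoef; last exact: L2_extend.
rewrite L2norm_sq (sqintE Lf) -(sqintE (L2_extend Lf)).
have [z [y [[z0 y1 y2] [_ -> ->]]]] := extend_normsq Lf.
rewrite -!EFinM !lee_fin.
set X := \sum_(k < n) cmod _ ^+ 2; set aX := \sum_(k < n) _ * _.
have X0 : 0 <= X by apply: sumr_ge0 => k _; exact: sqr_ge0.
have aX1 : al' * X <= aX.
  rewrite mulr_sumr; apply: ler_sum => k _; rewrite ler_wpM2r ?sqr_ge0//.
  by rewrite ge_min alP.
have aX2 : aX <= be * X.
  rewrite mulr_sumr; apply: ler_sum => k _; rewrite ler_wpM2r ?sqr_ge0//.
  rewrite /be (bigD1 k)//= -addrA lerDl addr_ge0 ?sumr_ge0//; last by lra.
  by move=> l _; exact: ltW.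
have y1' : al' * z <= y by rewrite (le_trans _ y1)// ler_wpM2r// ge_min lexx orbT.
have y2' : y <= be * z.
  rewrite (le_trans y2)// ler_wpM2r// /be addrCA lerDl addr_ge0 ?sumr_ge0//.
  by move=> l _; exact: ltW.
have r21 : 2 * r <= 1 by rewrite mulrC -ler_pdivlMr.
split.
  apply: (@le_trans _ _ (2 * r * (X + z))).
    rewrite mulrAC ler_pdivrMr// -[leRHS]mulrA ler_wpM2l ?mulr_ge0 ?(ltW r0)//.
    by rewrite mulrC mulrDr lerD.
  by rewrite mulrDr addrC lerD2r ler_piMl.
apply: (@le_trans _ _ (X + z)).
  by rewrite addrC lerD2r ler_piMl.
by rewrite mulrC ler_pdivlMr// mulrC mulrDr lerD.
Qed.

(** The squared error splits as [mu] does: the atoms give the pointwise errors at the b_k, and the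
    density part is at most [Mx] times the squared L2 error on [0,1], because f and [extend f] agree
    on [c,1). *)
Lemma dual_seq_dextrodual : dextrodual mu dual_seq e.
Proof.
split; first exact: L2_dual_seq.
split.
  move=> j; apply: (@L2_bounded _ _ _ _ _ 1) => //.
    exact: cmeasurable_expfun.
  by move=> x; rewrite cmod_expfun.
move=> f Lf; have LE := L2_extend Lf.
pose u M' := normsq mu (fun x => f x - fsum (extend f) M' x).
have Lfs N : L2 mu (fsum (extend f) N).
  apply: L2_sum => j; apply: L2Z; apply: (@L2_bounded _ _ _ _ _ 1) => //.
    exact: cmeasurable_expfun.
  by move=> x; rewrite cmod_expfun.
have Ld N : L2 mu (fun x => f x - fsum (extend f) N x) by exact: L2B.
have E N : L2norm mu
    (fun t => f t - symsum (fun j => L2dot mu f (dual_seq j) * e j t) N)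
   = (Num.sqrt (u N))%:E.
  have -> : (fun t => f t - symsum (fun j => L2dot mu f (dual_seq j) * e j t) N) =
      fun x => f x - fsum (extend f) N x.
    apply/funext => t; rewrite symsumE; congr (_ - _); apply: eq_bigr => j _.
    by rewrite L2dot_dual_seq.
  have := L2norm_sq mu (fun x => f x - fsum (extend f) N x).
  rewrite (sqintE (Ld N)) -/(u N).
  have : (0 <= L2norm mu (fun x => (f x - fsum (extend f) N x)%R))%E.
    exact: Lnorm_ge0.
  case: (L2norm mu _) => [l|//|//]; rewrite lee_fin => l0 [<-].
  by rewrite sqrtr_sqr ger0_norm.
under eq_fun do rewrite E.
apply: cvg_EFin_seq; rewrite -[X in _ --> X](@sqrtr0 R).
apply: continuous_cvg; first exact: sqrt_continuous.
apply: (@cvg0_squeeze _ _ (fun N =>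
  \sum_(k < n) a k * cmod (fsum (extend f) N (b k) - extend f (b k)) ^+ 2 +
  Mx * normsq nu (fun x => extend f x - fsum (extend f) N x))).
  move=> N; rewrite normsq_ge0/=.
  have := sqint_mu (L2_cmeasurable (Ld N)); rewrite (sqintE (Ld N)) -/(u N) => Eu.
  rewrite -lee_fin Eu EFinD; apply: leeD.
    rewrite lee_fin; apply: ler_sum => k _; rewrite (@extend_atom _ k); last first.
      by rewrite subrr normr0.
    by rewrite /cmod distrC.
  have /andP[_ h] := weighted_bounds (L2_cmeasurable (Ld N)).
  apply: le_trans h _; rewrite EFinM lee_wpmul2l//.
    by rewrite lee_fin /Mx le_max lexx orbT.
  rewrite -sqintE; last by apply: L2B => //; exact: L2_fsum.
  apply: ge0_le_integral => //.
  - by move=> x _; rewrite lee_fin mulr_ge0 ?sqr_ge0.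
  - apply/measurable_EFinP; apply: measurable_funM; first exact: measurable_tail.
    by apply: measurable_cmod_sq; exact: L2_cmeasurable (Ld N).
  - apply/measurable_EFinP/measurable_cmod_sq.
    exact: L2_cmeasurable (L2B LE (L2_fsum _ _)).
  move=> x _; rewrite lee_fin.
  have [xc|xc] := boolP (x \in `[c, 1[).
    by rewrite tail_in// mul1r extend_tail.
  by rewrite tail_out// mul0r sqr_ge0.
rewrite -[0 in X in _ --> X](addr0 0); apply: cvgD; last first.
  rewrite -[0 in X in _ --> X](mulr0 Mx); apply: cvgMr.
  exact/(parsevalP LE)/parseval_L2.
apply: (@cvg_sum0 _ _ _ (fun k N =>
    a k * cmod (fsum (extend f) N (b k) - extend f (b k)) ^+ 2)) => k.
rewrite -[0 in X in _ --> X](mulr0 (a k)); apply: cvgMr.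
apply: (fsum_cvg_of_gap LE (rho := r)); first by rewrite r0.
move=> y /andP[y0 y1] ne; apply/andP; split.
  rewrite leNgt; apply: contra ne => yk.
  rewrite (extend_atom _ yk) (@extend_atom _ k)//.
  by rewrite subrr normr0.
have := rb k; have := rc k; move: c1; rewrite ler_norml.
by move: (b k) => bk ? ? ?; apply/andP; split; lra.
Qed.

End Core.

(** * The measure of the theorem *)

Section Hypotheses.
Context {R : realType}.
Local Notation nu :=
  (lebesgue01 R : {measure set (measurableTypeR R) -> \bar R}).
Local Notation T := (measurableTypeR R).

Lemma integral_atoms_add (n : nat) (a b : 'I_n -> R)
    (mu mu_a : {measure set T -> \bar R}) : (forall k, 0 < a k) ->
  (forall A : set T, measurable A ->
    mu A = (\sum_(k < n) (a k)%:E * \d_(b k) A + mu_a A)%E) ->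
  forall h : T -> \bar R, measurable_fun setT h -> (forall x, (0 <= h x)%E) ->
  (\int[mu]_x h x = \sum_(k < n) (a k)%:E * h (b k) + \int[mu_a]_x h x)%E.
Proof.
move=> a0 mu_def h mh h0.
(* [msum] takes a sequence of measures indexed by [nat]; the zero measure fills the indices from n
   on, which are never summed. *)
pose atom (k : nat) : {measure set T -> \bar R} :=
  if insub k is Some i then mscale (NngNum (ltW (a0 i))) (\d_(b i : T)) else mzero.
rewrite (@eq_measure_integral _ _ _ setT (measure_add (msum atom n) mu_a)).
  rewrite ge0_integral_measure_add// ge0_integral_measure_sum//.
  congr (_ + _)%E; apply: eq_bigr => k _.
  by rewrite /atom valK ge0_integral_mscale// integral_dirac// diracT mul1e.
move=> A mA _; rewrite mu_def//= [RHS]measure_addE; congr (_ + _)%E.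
by apply: eq_bigr => k _; rewrite /atom valK.
Qed.

Lemma integral_density (mu_a : {finite_measure set T -> \bar R}) (w : T -> R) :
  mu_a `<< @lebesgue_measure R ->
  ae_eq (@lebesgue_measure R) setT
    ('d (charge_of_finite_measure mu_a) '/d (@lebesgue_measure R)) (EFin \o w) ->
  measurable_fun setT w -> (forall x, 0 <= w x) ->
  (forall x, x \notin `[0, 1[ -> w x = 0) ->
  forall h : T -> \bar R, measurable_fun setT h -> (forall x, (0 <= h x)%E) ->
  (\int[mu_a]_x h x = \int[nu]_x (h x * (w x)%:E))%E.
Proof.
move=> ac dens mw w0 w_supp h mh h0.
rewrite -(Radon_Nikodym_SigmaFinite.change_of_variables ac)//.
have mw' : measurable_fun setT (EFin \o w) by exact/measurable_EFinP.
have dw : ae_eq (@lebesgue_measure R) setT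
    (Radon_Nikodym_SigmaFinite.f mu_a (@lebesgue_measure R)) (EFin \o w).
  apply: ae_eq_trans dens.
  exact: ae_eq_Radon_Nikodym_SigmaFinite.
rewrite (@ge0_ae_eq_integral _ _ _ _ _ _ (fun x => h x * (w x)%:E)%E)//.
- rewrite integral_nu; last 2 first.
  + exact: emeasurable_funM.
  + by move=> x; rewrite mule_ge0// lee_fin.
  (* [nu] lives on the closed interval [0,1], outside which [w] vanishes, so restricting the
     integral loses nothing. *)
  rewrite [RHS]integral_mkcond; apply: eq_integral => x _; rewrite patchE.
  case: ifPn => // xn; rewrite w_supp ?mule0//.
  apply: contra xn => x01; rewrite mem_setE.
  by move: x01; rewrite !in_itv/= => /andP[-> /ltW ->].
- apply: emeasurable_funM => //.
  by apply: measurable_int; exact: Radon_Nikodym_SigmaFinite.f_integrable.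
- exact: emeasurable_funM.
- by move=> x _; rewrite mule_ge0// Radon_Nikodym_SigmaFinite.f_ge0.
- by move=> x _; rewrite mule_ge0// lee_fin.
- exact: ae_eqe_mul2l.
Qed.

(** The b_k may coincide, and then no disjoint intervals surround them; equal points are collapsed
    and their masses added. *)
Lemma merge_atoms (n : nat) (a b : 'I_n -> R) : (forall k, 0 < a k) ->
  exists (N : nat) (a' b' : 'I_N -> R), [/\ injective b',
    forall i, 0 < a' i, forall i, exists k, b' i = b k &
    forall h : R -> \bar R, (forall x, (0 <= h x)%E) ->
      (\sum_(k < n) (a k)%:E * h (b k) = \sum_(i < N) (a' i)%:E * h (b' i))%E].
Proof.
move=> a0; pose s := undup (codom b).
have bs k : b k \in s by rewrite mem_undup codom_f.
pose idx k : 'I_(size s) := Ordinal (etrans (index_mem (b k) s) (bs k)).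
exists (size s), (fun i => \sum_(k < n | idx k == i) a k), (fun i => nth 0 s i).
have idxE k : nth 0 s (idx k) = b k by rewrite nth_index.
have surj i : exists k, idx k == i.
  have : nth 0 s i \in codom b by rewrite -mem_undup mem_nth.
  move=> /codomP[k bk]; exists k; apply/eqP/val_inj => /=.
  by rewrite -bk index_uniq ?undup_uniq.
split.
- move=> i j /eqP; rewrite nth_uniq ?undup_uniq// => /eqP; exact: val_inj.
- move=> i; have [k ki] := surj i; rewrite (bigD1 k)//=.
  by rewrite ltr_pwDl// sumr_ge0// => l _; exact: ltW.
- by move=> i; have [k /eqP <-] := surj i; exists k.
- move=> h h0; rewrite (partition_big idx xpredT)//=; apply: eq_bigr => i _.
  rewrite -sumEFin ge0_sume_distrl; last by move=> k _; rewrite lee_fin ltW.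
  by apply: eq_bigr => k /eqP <-; rewrite idxE.
Qed.

Lemma separation_radius (n : nat) (b : 'I_n -> R) (c : R) : injective b ->
  (forall k, 0 < b k < c) ->
  exists r : R, [/\ 0 < r, r <= 1 / 2, forall k, r <= b k, forall k, b k + r <= c &
    forall k l, k != l -> 2 * r <= `|b k - b l|].
Proof.
move=> b_inj bc.
have [r1 r10 r1P] := @pos_lower_bound R _ b (fun k => proj1 (andP (bc k))).
have [r2 r20 r2P] := @pos_lower_bound R _ (fun k => c - b k)
  (fun k => etrans (subr_gt0 _ _) (proj2 (andP (bc k)))).
(* Diagonal pairs get the filler 1, so that the minimum over all pairs is positive. *)
have [|r3 r30 r3P] := @pos_lower_bound R _ (fun p : 'I_n * 'I_n =>
    if p.1 == p.2 then 1 else `|b p.1 - b p.2|).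
  move=> [k l] /=; case: eqVneq => // kl.
  by rewrite normr_gt0 subr_eq0 (inj_eq b_inj).
exists (Num.min (Num.min (1 / 2) (r3 / 2)) (Num.min r1 r2)); split.
- by rewrite !lt_min r10 r20 divr_gt0//= divr_gt0.
- by rewrite !ge_min lexx.
- by move=> k; rewrite !ge_min r1P !orbT.
- by move=> k; rewrite addrC -lerBrDr !ge_min r2P !orbT.
- move=> k l kl; have := r3P (k, l); rewrite /= (negbTE kl); apply: le_trans.
  by rewrite mulrC -ler_pdivlMr// !ge_min lexx orbT.
Qed.

End Hypotheses.

(* Borel measures on [0,1) are Borel measures on R that do not charge the
   complement of [0,1); here this follows from the shape of mu. *)
Theorem proposition3p9 (R : realType) (n : nat) (a b : 'I_n -> R) (c : R)
    (g : R -> R)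
    (mu : {measure set (measurableTypeR R) -> \bar R})
    (mu_a : {finite_measure set (measurableTypeR R) -> \bar R})
    (ha : forall k, 0 < a k)
    (hb : forall k, 0 < b k < c)
    (hc : 0 <= c <= 1)
    (gmeas : measurable_fun (`[0, 1[ : set (measurableTypeR R))
       (g : measurableTypeR R -> measurableTypeR R))
    (gbnd : ae_bounded_above_below `[0, 1[ g)
    (mu_a_ac : mu_a `<< @lebesgue_measure R)
    (mu_a_density : ae_eq (@lebesgue_measure R) setT
       ('d (charge_of_finite_measure mu_a) '/d (@lebesgue_measure R))
       (fun x => (\1_(`[c, 1[) x * g x)%:E))
    (mu_def : forall A : set (measurableTypeR R), measurable A ->
       mu A = (\sum_(k < n) (a k)%:E * \d_(b k) A + mu_a A)%E) :
  exists gs : int -> measurableTypeR R -> R[i],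
    is_frame mu gs /\ dextrodual mu gs expfun.
Proof.
have [m [M [m0 [mM gmM]]]] := gbnd; have /andP[c0 c1] := hc.
(* Clamping g to [m,M] makes its almost-everywhere bounds hold at every point, and extending it by 0
   off [0,1) makes it measurable on R; the density changes only on a null set. *)
pose w (x : measurableTypeR R) : R :=
  \1_(`[c, 1[) x * Num.max m (Num.min M ((g \_ `[0, 1[) x)).
have mw : measurable_fun setT w.
  apply: measurable_funM; first by apply: measurable_indic; exact: measurable_itv.
  apply: measurable_maxr; first exact: measurable_cst.
  apply: measurable_minr; first exact: measurable_cst.
  exact: ((@measurable_restrictT _ _ (measurableTypeR R) (measurableTypeR R)
    `[0, 1[%classic g (measurable_itv _)).1 gmeas).
have w_supp x : x \notin `[c, 1[ -> w x = 0.
  by move=> xc; rewrite /w indicE memNset ?mul0r//=; exact/negP.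
have w_bnd x : x \in `[c, 1[ -> m <= w x <= M.
  move=> xc; rewrite /w indicE mem_set//= mul1r le_max lexx/=.
  by rewrite ge_max mM ge_min lexx.
have w0 x : 0 <= w x.
  by rewrite mulr_ge0// le_max (ltW m0).
have w_supp01 x : x \notin `[0, 1[ -> w x = 0.
  move=> x01; apply: w_supp; apply: contra x01; rewrite !in_itv/= => /andP[cx ->].
  by rewrite (le_trans c0).
have dens : ae_eq (@lebesgue_measure R) setT
    ('d (charge_of_finite_measure mu_a) '/d (@lebesgue_measure R)) (EFin \o w).
  apply: ae_eq_trans mu_a_density _; have [A [mA A0 sA]] := gmM.
  exists A; split => //; apply: subset_trans sA => x /= nE gx; apply: nE => _.
  rewrite /w; have [xc|xc] := boolP (x \in `[c, 1[); last first.
    by rewrite indicE memNset ?mul0r//=; exact/negP.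
  have x01 : x \in `[0, 1[.
    by move: xc; rewrite !in_itv/= => /andP[cx ->]; rewrite (le_trans c0).
  have /andP[g1 g2] := gx x01.
  rewrite patchE mem_set//; congr (_ * _)%:E.
  by rewrite min_r// max_r.
have [N [a' [b' [b'_inj a'0 b'b sumE]]]] := merge_atoms b ha.
have b'c i : 0 < b' i < c by have [k ->] := b'b i.
have [r [r0 r2 rb rc rsep]] := separation_radius b'_inj b'c.
have mu_int (h : measurableTypeR R -> \bar R) : measurable_fun setT h ->
    (forall x, (0 <= h x)%E) ->
    (\int[mu]_x h x = \sum_(k < N) (a' k)%:E * h (b' k) +
       \int[lebesgue01 R]_x (h x * (w x)%:E))%E.
  move=> mh h0; rewrite (integral_atoms_add ha mu_def)// sumE//.
  by rewrite (integral_density mu_a_ac dens).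
exists (dual_seq a' b' c w r); split.
- exact: (@dual_seq_frame _ _ _ _ _ m M).
- exact: (@dual_seq_dextrodual _ _ _ _ _ m M).
Qed.
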